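(* Let $\mathscr{C}$ be a fiat $2$-category over a field $\Bbbk$, let $\mathcal{J}$ be a (non-zero) two-sided cell in $\mathscr{C}$ and let $\mathcal{L}$ be a left cell in $\mathcal{J}$. Let $\mathbf{C}_{\mathcal{L}}$ be the additive cell $2$-representation of $\mathscr{C}$ associated to $\mathcal{L}$. Then the quotient $2$-category $\mathscr{C}/\mathrm{Ker}(\mathbf{C}_{\mathcal{L}})$ is $\mathcal{J}$-simple.
   Context: **Fiat $2$-categories.** A $2$-category is a (strict) category enriched over small categories; $\circ$ is composition of $1$-morphisms, $\circ_0$ and $\circ_1$ are horizontal and vertical composition of $2$-morphisms; $\mathrm{F}(\alpha):=\mathrm{id}_{\mathrm{F}}\circ_0\alpha$ and $\alpha_{\mathrm{F}}:=\alpha\circ_0\mathrm{id}_{\mathrm{F}}$. ''Fully additive'' means additive with split idempotents. A $2$-category $\mathscr{C}$ is fiat over the field $\Bbbk$ if: it has finitely many objects; every $\mathscr{C}(\mathtt{i},\mathtt{j})$ is a fully additive $\Bbbk$-linear category with finitely many indecomposable objects up to isomorphism; horizontal compositions are additive and $\Bbbk$-linear; all spaces of $2$-morphisms are finite dimensional; all identity $1$-morphisms $\mathbb{1}_{\mathtt{i}}$ are indecomposable; $\mathscr{C}$ has a weak object-preserving involutive anti-autoequivalence $*$; and for every $1$-morphism $\mathrm{F}\in\mathscr{C}(\mathtt{i},\mathtt{j})$ there are $2$-morphisms $\alpha:\mathrm{F}\circ\mathrm{F}^*\to\mathbb{1}_{\mathtt{j}}$, $\beta:\mathbb{1}_{\mathtt{i}}\to\mathrm{F}^*\circ\mathrm{F}$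 with $\alpha_{\mathrm{F}}\circ_1\mathrm{F}(\beta)=\mathrm{id}_{\mathrm{F}}$ and $\mathrm{F}^*(\alpha)\circ_1\beta_{\mathrm{F}^*}=\mathrm{id}_{\mathrm{F}^*}$. **Cells.** Indecomposable $1$-morphisms are identified with their isomorphism classes. For indecomposable $1$-morphisms write $\mathrm{F}\leq_L\mathrm{G}$ (resp. $\mathrm{F}\leq_R\mathrm{G}$, $\mathrm{F}\leq_J\mathrm{G}$) if $\mathrm{G}$ is isomorphic to a direct summand of $\mathrm{H}\circ\mathrm{F}$ (resp. $\mathrm{F}\circ\mathrm{H}$, $\mathrm{H}\circ\mathrm{F}\circ\mathrm{H}'$) for some $1$-morphisms $\mathrm{H},\mathrm{H}'$. These are preorders; the classes of the induced equivalence relations $\sim_L,\sim_R,\sim_J$ are the (non-zero) left, right and two-sided cells. **$2$-representations.** An additive (resp. finitary, abelian) $2$-representation of $\mathscr{C}$ is a $2$-functor from $\mathscr{C}$ to the $2$-category of small fully additive $\Bbbk$-linear categories (resp. such categories with finitely many indecomposables up to isomorphism, resp. such categories equivalent to module categories of finite dimensional $\Bbbk$-algebras), additive $\Bbbk$-linear functors and natural transformations. One writes $\mathrm{F}\,X$ for $\mathbf{M}(\mathrm{F})(X)$. *Abelianization.* For a finitary $\mathbf{M}$, $\overline{\mathbf{M}}(\mathtt{i})$ has objects the morphisms $X\xrightarrow{\alpha}Y$ of $\mathbf{M}(\mathtt{i})$; morphisms from $X\xrightarrow{\alpha}Y$ to $X'\xrightarrow{\alpha'}Y'$ are pairs $(\beta:X\to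 X',\gamma:Y\to Y')$ with $\gamma\alpha=\alpha'\beta$, modulo those for which there is $\xi:Y\to X'$ with $\gamma=\alpha'\xi$. $\mathscr{C}$ acts component-wise. *Cell $2$-representations.* $\mathbb{P}_{\mathtt{i}}:=\mathscr{C}(\mathtt{i},{}_-)$ is the principal additive $2$-representation and $\overline{\mathbb{P}}_{\mathtt{i}}$ its abelianization. For indecomposable $\mathrm{F}\in\mathscr{C}(\mathtt{i},\mathtt{j})$, $P_{\mathrm{F}}$ is the indecomposable projective object $0\to\mathrm{F}$ of $\overline{\mathbb{P}}_{\mathtt{i}}(\mathtt{j})$ and $L_{\mathrm{F}}$ is its simple top. For a left cell $\mathcal{L}$ there is an object $\mathtt{i}=\mathtt{i}_{\mathcal{L}}$ such that every $\mathrm{F}\in\mathcal{L}$ lies in $\mathscr{C}(\mathtt{i},\mathtt{j})$ for some $\mathtt{j}$. It is known (Mazorchuk–Miemietz) that there is a unique $\mathrm{G}_{\mathcal{L}}\in\mathcal{L}$ (the Duflo involution) such that $P_{\mathbb{1}_{\mathtt{i}}}$ has a unique quotient $N$ whose socle is simple and isomorphic to $L_{\mathrm{G}_{\mathcal{L}}}$ and with $\mathrm{F}\,(N/L_{\mathrm{G}_{\mathcal{L}}})=0$ for all $\mathrm{F}\in\mathcal{L}$. Put $Q:=\mathrm{G}_{\mathcal{L}}\,L_{\mathrm{G}_{\mathcal{L}}}\in\overline{\mathbb{P}}_{\mathtt{i}}(\mathtt{i})$. The additive cell $2$-representation $\mathbf{C}_{\mathcal{L}}$ assigns to $\mathtt{j}$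 the additive closure in $\overline{\mathbb{P}}_{\mathtt{i}}(\mathtt{j})$ of all $\mathrm{F}\,Q$, $\mathrm{F}\in\mathscr{C}(\mathtt{i},\mathtt{j})$, with the action of $\mathscr{C}$ restricted from $\overline{\mathbb{P}}_{\mathtt{i}}$. **$2$-ideals.** A $2$-ideal $\mathscr{I}$ of $\mathscr{C}$ is a choice of $\Bbbk$-subspaces $\mathrm{Hom}_{\mathscr{I}}(\mathrm{F},\mathrm{G})\subset\mathrm{Hom}_{\mathscr{C}(\mathtt{i},\mathtt{j})}(\mathrm{F},\mathrm{G})$ for all $\mathrm{F},\mathrm{G}\in\mathscr{C}(\mathtt{i},\mathtt{j})$ and all $\mathtt{i},\mathtt{j}$, closed under horizontal and vertical composition on both sides with arbitrary $2$-morphisms of $\mathscr{C}$. The quotient $\mathscr{C}/\mathscr{I}$ has the same objects and $1$-morphisms and $2$-morphism spaces $\mathrm{Hom}_{\mathscr{C}(\mathtt{i},\mathtt{j})}(\mathrm{F},\mathrm{G})/\mathrm{Hom}_{\mathscr{I}}(\mathrm{F},\mathrm{G})$. For a $2$-representation $\mathbf{M}$, $\mathrm{Ker}(\mathbf{M})$ is the $2$-ideal of all $2$-morphisms $\alpha$ with $\mathbf{M}(\alpha)=0$. **$\mathcal{J}$-simplicity.** A $2$-category $\mathscr{A}$ with a non-zero two-sided cell $\mathcal{J}$ is $\mathcal{J}$-simple if every non-zero $2$-ideal of $\mathscr{A}$ contains $\mathrm{id}_{\mathrm{F}}$ for some $\mathrm{F}\in\mathcal{J}$. For a quotient $\mathscr{C}/\mathscr{I}$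 of $\mathscr{C}$ and a two-sided cell $\mathcal{J}$ of $\mathscr{C}$, ''$\mathscr{C}/\mathscr{I}$ is $\mathcal{J}$-simple'' refers to the image of $\mathcal{J}$ in $\mathscr{C}/\mathscr{I}$, which is required to be non-zero (that is, $\mathrm{id}_{\mathrm{F}}\notin\mathscr{I}$ for $\mathrm{F}\in\mathcal{J}$). *)

(* Defs.v *)
From HB Require Import structures.
From mathcomp Require Import all_boot all_algebra boolp.
Set Implicit Arguments.
Unset Strict Implicit.
Unset Printing Implicit Defensive.
Import GRing.Theory.
Local Open Scope ring_scope.
Local Open Scope quotient_scope.

(* Subspaces S of a k-vector space V, and S and V/S as lmodTypes. *)
Section SubQuotient.
Variables (k : fieldType) (V : lmodType k).

Record submod := Submod {
  inS :> V -> Prop;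
  inS0 : inS 0;
  inSP : forall (a : k) (x y : V), inS x -> inS y -> inS (a *: x + y) }.

Variable S : submod.

Lemma inSD x y : S x -> S y -> S (x + y).
Proof. by move=> Sx Sy; rewrite -[x]scale1r; exact: inSP. Qed.
Lemma inSZ a x : S x -> S (a *: x).
Proof. by move=> Sx; rewrite -[_ *: _]addr0; apply: inSP => //; exact: inS0. Qed.
Lemma inSN x : S x -> S (- x).
Proof. by rewrite -scaleN1r; exact: inSZ. Qed.

Definition submod_pred : {pred V} := fun x => `[< S x >].
Lemma submod_pred_closed : submod_closed submod_pred.
Proof.
split; first by apply/asboolP; exact: inS0.
by move=> a x y /asboolP Sx /asboolP Sy; apply/asboolP; exact: inSP.
Qed.
HB.instance Definition _ :=
  GRing.isSubmodClosed.Build k V submod_pred submod_pred_closed.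

Record subLmod := SubLmod { sub_val : V; _ : submod_pred sub_val }.
HB.instance Definition _ := [isSub for sub_val].
HB.instance Definition _ := [Choice of subLmod by <:].
HB.instance Definition _ := [SubChoice_isSubLmodule of subLmod by <:].

Definition mkSub (x : V) (Sx : S x) : subLmod :=
  SubLmod (introT (asboolP (S x)) Sx).
Lemma subLmodP (x : subLmod) : S (val x).
Proof. by case: x => x /= /asboolP. Qed.

Definition quot_rel (x y : V) := submod_pred (x - y).
Lemma quot_rel_equiv : equiv_class_of quot_rel.
Proof.
split.
- by move=> x; apply/asboolP; rewrite subrr; exact: inS0.
- by move=> x y; apply/asboolP/asboolP => /inSN; rewrite opprB.
- move=> y x z /asboolP xy /asboolP yz; apply/asboolP.
  by rewrite -(subrKA y); exact: inSD.
Qed.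
Canonical quot_equiv := EquivRelPack quot_rel_equiv.

Definition quotLmod := {eq_quot quot_equiv}.
HB.instance Definition _ : EqQuotient V quot_equiv quotLmod := EqQuotient.on quotLmod.
HB.instance Definition _ := Choice.on quotLmod.

Definition qpi (x : V) : quotLmod := \pi_quotLmod x.

Lemma qpi_eq x y : qpi x = qpi y <-> S (x - y).
Proof.
split; first by move/eqmodP/asboolP.
by move=> Sxy; apply/eqmodP/asboolP.
Qed.
Lemma qpi_surj (u : quotLmod) : exists x, u = qpi x.
Proof. by exists (repr u); rewrite /qpi reprK. Qed.
Lemma repr_qpi x : S (repr (qpi x) - x).
Proof. by apply/qpi_eq; rewrite /qpi reprK. Qed.

Definition qadd (u v : quotLmod) := qpi (repr u + repr v).
Definition qopp (u : quotLmod) := qpi (- repr u).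
Definition qscale (a : k) (u : quotLmod) := qpi (a *: repr u).

Lemma qaddE x y : qadd (qpi x) (qpi y) = qpi (x + y).
Proof. by apply/qpi_eq; rewrite opprD addrACA; apply: inSD; exact: repr_qpi. Qed.
Lemma qoppE x : qopp (qpi x) = qpi (- x).
Proof. by apply/qpi_eq; rewrite -opprD; apply: inSN; exact: repr_qpi. Qed.
Lemma qscaleE a x : qscale a (qpi x) = qpi (a *: x).
Proof. by apply/qpi_eq; rewrite -scalerBr; apply: inSZ; exact: repr_qpi. Qed.

Lemma qaddA : associative qadd.
Proof.
move=> u v w; case: (qpi_surj u) (qpi_surj v) (qpi_surj w) => x -> [y ->] [z ->].
by rewrite !qaddE addrA.
Qed.
Lemma qaddC : commutative qadd.
Proof.
move=> u v; case: (qpi_surj u) (qpi_surj v) => x -> [y ->].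
by rewrite !qaddE addrC.
Qed.
Lemma qadd0 : left_id (qpi 0) qadd.
Proof. by move=> u; case: (qpi_surj u) => x ->; rewrite qaddE add0r. Qed.
Lemma qaddN : left_inverse (qpi 0) qopp qadd.
Proof. by move=> u; case: (qpi_surj u) => x ->; rewrite qoppE qaddE addNr. Qed.
HB.instance Definition _ :=
  GRing.isZmodule.Build quotLmod qaddA qaddC qadd0 qaddN.

Lemma qscaleA a b u : qscale a (qscale b u) = qscale (a * b) u.
Proof. by case: (qpi_surj u) => x ->; rewrite !qscaleE scalerA. Qed.
Lemma qscale1 : left_id 1 qscale.
Proof. by move=> u; case: (qpi_surj u) => x ->; rewrite qscaleE scale1r. Qed.
Lemma qscaleDr : right_distributive qscale +%R.
Proof.
move=> a u v; case: (qpi_surj u) (qpi_surj v) => x -> [y ->].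
by rewrite [_ + _]qaddE !qscaleE [RHS]qaddE scalerDr.
Qed.
Lemma qscaleDl u : {morph qscale^~ u : a b / a + b}.
Proof.
by move=> a b; case: (qpi_surj u) => x ->; rewrite !qscaleE [RHS]qaddE scalerDl.
Qed.
HB.instance Definition _ :=
  GRing.Zmodule_isLmodule.Build k quotLmod qscaleA qscale1 qscaleDr qscaleDl.

Lemma qpi_linear : linear qpi.
Proof. by move=> a x y; rewrite [a *: qpi x]qscaleE [RHS]qaddE. Qed.
HB.instance Definition _ := GRing.isLinear.Build k V quotLmod _ qpi qpi_linear.
Lemma qpi0 x : qpi x = 0 <-> S x.
Proof. by rewrite -[x in S x]subr0; exact: qpi_eq. Qed.
End SubQuotient.

Record linCat (k : fieldType) := LinCat {
  ob :> Type;
  hom : ob -> ob -> lmodType k;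
  idm : forall X, hom X X;
  comp : forall X Y Z, hom Y Z -> hom X Y -> hom X Z;
  compA : forall W X Y Z (h : hom Y Z) (g : hom X Y) (f : hom W X),
    comp h (comp g f) = comp (comp h g) f;
  comp1m : forall X Y (f : hom X Y), comp (idm Y) f = f;
  compm1 : forall X Y (f : hom X Y), comp f (idm X) = f;
  comp_linl : forall X Y Z (f : hom X Y), linear (fun g : hom Y Z => comp g f);
  comp_linr : forall X Y Z (g : hom Y Z), linear (fun f : hom X Y => comp g f) }.

Arguments hom {k l} X Y : rename.
Arguments idm {k l} X : rename.
Arguments comp {k l X Y Z} g f : rename.
Notation "g \o1 f" := (comp g f) (at level 45, left associativity, format "g  \o1  f").

(* The morphism X -> Y given by an equality of objects X = Y; every strictness
   law below is an equality of objects together with an equation stating that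
   the morphisms agree up to these canonical identifications. *)
Definition idto k (A : linCat k) (X Y : A) (e : X = Y) : hom X Y :=
  match e in _ = Z return hom X Z with erefl => idm X end.

Section CatNotions.
Variables (k : fieldType) (A : linCat k).

Lemma idto1 (X : A) (e : X = X) : idto e = idm X.
Proof. by rewrite (Prop_irrelevance e erefl). Qed.
Lemma comp0m (X Y Z : A) (f : hom X Y) : (0 : hom Y Z) \o1 f = 0.
Proof.
by have /= := comp_linl f (-1) (0 : hom Y Z) 0;
   rewrite scaler0 addr0 scaleN1r addNr.
Qed.
Lemma compm0 (X Y Z : A) (g : hom Y Z) : g \o1 (0 : hom X Y) = 0.
Proof.
by have /= := comp_linr g (-1) (0 : hom X Y) 0;
   rewrite scaler0 addr0 scaleN1r addNr.
Qed.
Lemma compDl (X Y Z : A) (g g' : hom Y Z) (f : hom X Y) :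
  (g + g') \o1 f = g \o1 f + g' \o1 f.
Proof. by have /= := comp_linl f 1 g g'; rewrite !scale1r. Qed.
Lemma compDr (X Y Z : A) (g : hom Y Z) (f f' : hom X Y) :
  g \o1 (f + f') = g \o1 f + g \o1 f'.
Proof. by have /= := comp_linr g 1 f f'; rewrite !scale1r. Qed.
Lemma compZl (X Y Z : A) a (g : hom Y Z) (f : hom X Y) :
  (a *: g) \o1 f = a *: (g \o1 f).
Proof. by have /= := comp_linl f a g 0; rewrite comp0m !addr0. Qed.
Lemma compZr (X Y Z : A) a (g : hom Y Z) (f : hom X Y) :
  g \o1 (a *: f) = a *: (g \o1 f).
Proof. by have /= := comp_linr g a f 0; rewrite compm0 !addr0. Qed.
Lemma compBr (X Y Z : A) (g : hom Y Z) (f f' : hom X Y) :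
  g \o1 (f - f') = g \o1 f - g \o1 f'.
Proof. by rewrite compDr -scaleN1r compZr scaleN1r. Qed.
Lemma compBl (X Y Z : A) (g g' : hom Y Z) (f : hom X Y) :
  (g - g') \o1 f = g \o1 f - g' \o1 f.
Proof. by rewrite compDl -scaleN1r compZl scaleN1r. Qed.

Definition is_iso (X Y : A) (f : hom X Y) : Prop :=
  exists g : hom Y X, g \o1 f = idm X /\ f \o1 g = idm Y.
Definition isomorphic (X Y : A) : Prop := exists f : hom X Y, is_iso f.
Definition is_zero (X : A) : Prop :=
  forall Y, (forall f : hom X Y, f = 0) /\ (forall f : hom Y X, f = 0).
Definition is_biproduct (X Y Z : A) : Prop :=
  exists (i1 : hom X Z) (p1 : hom Z X) (i2 : hom Y Z) (p2 : hom Z Y),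
    [/\ p1 \o1 i1 = idm X, p2 \o1 i2 = idm Y, p1 \o1 i2 = 0, p2 \o1 i1 = 0
      & i1 \o1 p1 + i2 \o1 p2 = idm Z].
Definition is_summand (X Z : A) : Prop := exists Y, is_biproduct X Y Z.
Definition indecomposable (X : A) : Prop :=
  ~ is_zero X /\ forall Y Z, is_biproduct Y Z X -> is_zero Y \/ is_zero Z.

Definition has_zero : Prop := exists Z : A, is_zero Z.
Definition zero_ob (hz : has_zero) : A := projT1 (cid hz).

Definition fully_additive : Prop :=
  [/\ has_zero, forall X Y : A, exists Z, is_biproduct X Y Z
    & forall (X : A) (e : hom X X), e \o1 e = e ->
        exists (Y : A) (r : hom X Y) (s : hom Y X),
          r \o1 s = idm Y /\ s \o1 r = e].

Definition fin_indecomposables : Prop :=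
  exists (n : nat) (e : 'I_n -> A),
    forall X, indecomposable X -> exists a, isomorphic X (e a).

Definition is_mono (X Y : A) (f : hom X Y) : Prop :=
  forall W (g g' : hom W X), f \o1 g = f \o1 g' -> g = g'.
Definition is_epi (X Y : A) (f : hom X Y) : Prop :=
  forall W (g g' : hom Y W), g \o1 f = g' \o1 f -> g = g'.
Definition is_cokernel (X Y Z : A) (f : hom X Y) (c : hom Y Z) : Prop :=
  c \o1 f = 0 /\
  forall W (g : hom Y W), g \o1 f = 0 -> exists! h : hom Z W, h \o1 c = g.

Definition is_simple (X : A) : Prop :=
  ~ is_zero X /\
  forall W (m : hom W X), is_mono m -> is_zero W \/ is_iso m.
Inductive semisimple : A -> Prop :=
| ss_zero X : is_zero X -> semisimple X
| ss_simple X : is_simple X -> semisimple X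
| ss_sum X Y Z : semisimple X -> semisimple Y -> is_biproduct X Y Z ->
    semisimple Z.

(* top: the largest semisimple quotient; socle: the largest semisimple
   subobject. *)
Definition is_top (P T : A) (t : hom P T) : Prop :=
  [/\ is_epi t, semisimple T &
    forall S (q : hom P S), semisimple S -> exists q' : hom T S, q = q' \o1 t].
Definition is_socle (S N : A) (s : hom S N) : Prop :=
  [/\ is_mono s, semisimple S &
    forall T (q : hom T N), semisimple T -> exists q' : hom T S, q = s \o1 q'].
Definition simple_top (P T : A) : Prop :=
  is_simple T /\ exists t : hom P T, is_top t.

Inductive additive_closure (S : A -> Prop) : A -> Prop :=
| ac_in X : S X -> additive_closure S X
| ac_zero X : is_zero X -> additive_closure S X
| ac_sum X Y Z : additive_closure S X -> additive_closure S Y ->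
    is_biproduct X Y Z -> additive_closure S Z
| ac_summand X Z : additive_closure S Z -> is_summand X Z ->
    additive_closure S X.

End CatNotions.

Record linFun k (A B : linCat k) := LinFun {
  fob :> A -> B;
  fmor : forall X Y : A, hom X Y -> hom (fob X) (fob Y);
  fmor1 : forall X : A, fmor (idm X) = idm (fob X);
  fmorM : forall (X Y Z : A) (g : hom Y Z) (f : hom X Y),
    fmor (g \o1 f) = fmor g \o1 fmor f;
  fmor_lin : forall X Y : A, linear (@fmor X Y) }.

Lemma fmorD k (A B : linCat k) (F : linFun A B) (X Y : A) (f g : hom X Y) :
  fmor F (f + g) = fmor F f + fmor F g.
Proof. by have := fmor_lin F 1 f g; rewrite !scale1r. Qed.
Lemma fmor0 k (A B : linCat k) (F : linFun A B) (X Y : A) :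
  fmor F (0 : hom X Y) = 0.
Proof.
by have := fmor_lin F (-1) (0 : hom X Y) 0; rewrite scaler0 addr0 scaleN1r addNr.
Qed.
Lemma fmorB k (A B : linCat k) (F : linFun A B) (X Y : A) (f g : hom X Y) :
  fmor F (f - g) = fmor F f - fmor F g.
Proof.
by rewrite [f - g]addrC [RHS]addrC -!scaleN1r; exact: fmor_lin.
Qed.

Lemma is_zero_id k (A : linCat k) (X : A) : idm X = 0 -> is_zero X.
Proof.
move=> X0 Y; split=> f.
- by rewrite -(compm1 f) X0 compm0.
- by rewrite -(comp1m f) X0 comp0m.
Qed.

Lemma fun_zero k (A B : linCat k) (F : linFun A B) X : is_zero X -> is_zero (F X).
Proof.
move=> X0; apply: is_zero_id.
by rewrite -fmor1 (proj1 (X0 X) (idm X)) fmor0.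
Qed.
Lemma fun_biproduct k (A B : linCat k) (F : linFun A B) X Y Z :
  is_biproduct X Y Z -> is_biproduct (F X) (F Y) (F Z).
Proof.
case=> i1 [p1] [i2] [p2] [e1 e2 e3 e4 e5].
exists (fmor F i1), (fmor F p1), (fmor F i2), (fmor F p2).
by split; rewrite -!fmorM -?fmorD ?e1 ?e2 ?e3 ?e4 ?e5 ?fmor1 ?fmor0.
Qed.

(* Strict k-linear 2-categories: [cell i j] is the category C(i,j), [cmp1] the
   composition of 1-morphisms and [cmp2] the horizontal composition of
   2-morphisms; vertical composition is [\o1] in [cell i j]. *)
Record lin2Cat (k : fieldType) := Lin2Cat {
  obj : Type;
  cell : obj -> obj -> linCat k;
  one : forall i, cell i i;
  cmp1 : forall i j l, cell j l -> cell i j -> cell i l;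
  cmp2 : forall i j l (G G' : cell j l) (F F' : cell i j),
    hom G G' -> hom F F' -> hom (cmp1 G F) (cmp1 G' F');
  cmp2_id : forall i j l (G : cell j l) (F : cell i j),
    cmp2 (idm G) (idm F) = idm (cmp1 G F);
  interchange : forall i j l (G G' G'' : cell j l) (F F' F'' : cell i j)
      (b' : hom G' G'') (b : hom G G') (a' : hom F' F'') (a : hom F F'),
    cmp2 (b' \o1 b) (a' \o1 a) = cmp2 b' a' \o1 cmp2 b a;
  cmp2_linl : forall i j l (G G' : cell j l) (F F' : cell i j) (a : hom F F'),
    linear (fun b : hom G G' => cmp2 b a);
  cmp2_linr : forall i j l (G G' : cell j l) (F F' : cell i j) (b : hom G G'),
    linear (fun a : hom F F' => cmp2 b a);
  cmp1A : forall i j l m (H : cell l m) (G : cell j l) (F : cell i j),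
    cmp1 H (cmp1 G F) = cmp1 (cmp1 H G) F;
  cmp1_1m : forall i j (F : cell i j), cmp1 (one j) F = F;
  cmp1_m1 : forall i j (F : cell i j), cmp1 F (one i) = F;
  cmp2A : forall i j l m (H H' : cell l m) (G G' : cell j l) (F F' : cell i j)
      (c : hom H H') (b : hom G G') (a : hom F F'),
    idto (cmp1A H' G' F') \o1 cmp2 c (cmp2 b a)
    = cmp2 (cmp2 c b) a \o1 idto (cmp1A H G F);
  cmp2_1m : forall i j (F F' : cell i j) (a : hom F F'),
    idto (cmp1_1m F') \o1 cmp2 (idm (one j)) a = a \o1 idto (cmp1_1m F);
  cmp2_m1 : forall i j (F F' : cell i j) (a : hom F F'),
    idto (cmp1_m1 F') \o1 cmp2 a (idm (one i)) = a \o1 idto (cmp1_m1 F) }.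

Arguments cell {k l} i j : rename.
Arguments one {k l} i : rename.
Arguments cmp1 {k l i j l0} G F : rename.
Arguments cmp2 {k l i j l0 G G' F F'} b a : rename.
Notation "G \oo F" := (cmp1 G F) (at level 42, left associativity, format "G  \oo  F").
Notation "b \o0 a" := (cmp2 b a) (at level 44, left associativity, format "b  \o0  a").

Section Fiat.
Variables (k : fieldType) (C : lin2Cat k).

(* A pseudofunctor (st, st2, st_mu, st_up) from C to C with 1- and 2-morphisms
   reversed, the identity on objects, together with an isomorphism st_eta from
   the identity to its square that is pseudonatural with identity components
   on objects; in particular it is an anti-autoequivalence. *)
Record weak_involution := WeakInvolution {
  st :> forall i j : obj C, cell i j -> cell j i;
  st2 : forall i j (F G : cell i j), hom F G -> hom (st G) (st F);
  st2_id : forall i j (F : cell i j), st2 (idm F) = idm (st F);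
  st2_comp : forall i j (F G H : cell i j) (b : hom G H) (a : hom F G),
    st2 (b \o1 a) = st2 a \o1 st2 b;
  st_mu : forall i j l (G : cell j l) (F : cell i j),
    hom (st F \oo st G) (st (G \oo F));
  st_mu_iso : forall i j l (G : cell j l) (F : cell i j), is_iso (st_mu G F);
  st_mu_nat : forall i j l (G G' : cell j l) (F F' : cell i j)
      (b : hom G G') (a : hom F F'),
    st2 (b \o0 a) \o1 st_mu G' F' = st_mu G F \o1 (st2 a \o0 st2 b);
  st_up : forall i, hom (one i) (st (one i));
  st_up_iso : forall i, is_iso (st_up i);
  st_muA : forall i j l m (H : cell l m) (G : cell j l) (F : cell i j),
    st2 (idto (cmp1A H G F)) \o1 (st_mu (H \oo G) F \o1 (idm (st F) \o0 st_mu H G))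
    = st_mu H (G \oo F) \o1 (st_mu G F \o0 idm (st H))
        \o1 idto (cmp1A (st F) (st G) (st H));
  st_mu1m : forall i j (F : cell i j),
    st_mu (one j) F \o1 (idm (st F) \o0 st_up j)
    = st2 (idto (cmp1_1m F)) \o1 idto (cmp1_m1 (st F));
  st_mum1 : forall i j (F : cell i j),
    st_mu F (one i) \o1 (st_up i \o0 idm (st F))
    = st2 (idto (cmp1_m1 F)) \o1 idto (cmp1_1m (st F));
  st_eta : forall i j (F : cell i j), hom F (st (st F));
  st_eta_iso : forall i j (F : cell i j), is_iso (st_eta F);
  st_eta_nat : forall i j (F G : cell i j) (a : hom F G),
    st_eta G \o1 a = st2 (st2 a) \o1 st_eta F;
  st_eta_cmp : forall i j l (G : cell j l) (F : cell i j),
    st2 (st_mu G F) \o1 st_eta (G \oo F)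
    = st_mu (st F) (st G) \o1 (st_eta G \o0 st_eta F);
  st_eta_one : forall i, st2 (st_up i) \o1 st_eta (one i) = st_up i }.

Definition fin_dim (V : lmodType k) : Prop :=
  exists (n : nat) (e : 'I_n -> V),
    forall v, exists c : 'I_n -> k, v = \sum_(a < n) c a *: e a.

(* The two zig-zag identities
     alpha_F \o1 F(beta) = id_F   and   F'(alpha) \o1 beta_F' = id_F',
   with the strict associativity and unit identifications inserted. *)
Definition adjoint_pair (i j : obj C) (F : cell i j) (F' : cell j i) : Prop :=
  exists (alpha : hom (F \oo F') (one j)) (beta : hom (one i) (F' \oo F)),
    idto (cmp1_1m F) \o1 (alpha \o0 idm F) \o1 idto (cmp1A F F' F)
      \o1 (idm F \o0 beta) \o1 idto (esym (cmp1_m1 F)) = idm F /\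
    idto (cmp1_m1 F') \o1 (idm F' \o0 alpha) \o1 idto (esym (cmp1A F' F F'))
      \o1 (beta \o0 idm F') \o1 idto (esym (cmp1_1m F')) = idm F'.

Record fiat : Prop := Fiat {
  fiat_obj : exists (n : nat) (e : 'I_n -> obj C), forall i, exists a, e a = i;
  fiat_add : forall i j : obj C, fully_additive (cell i j);
  fiat_ind : forall i j : obj C, fin_indecomposables (cell i j);
  fiat_fd : forall (i j : obj C) (F G : cell i j), fin_dim (hom F G);
  fiat_one : forall i : obj C, indecomposable (one i);
  fiat_star : exists S : weak_involution,
    forall (i j : obj C) (F : cell i j), adjoint_pair F (S i j F) }.

Lemma fiat_zero (hC : fiat) (i j : obj C) : has_zero (cell i j).
Proof. by case: (fiat_add hC i j). Qed.

Record onemor := OneMor { src : obj C; tgt : obj C; mor :> cell src tgt }.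

(* Indecomposable 1-morphisms are identified up to isomorphism: cells are
   isomorphism-closed predicates on 1-morphisms bundled with their source and
   target. *)
Inductive leL : onemor -> onemor -> Prop :=
  LeL i j l (F : cell i j) (G : cell i l) (H : cell j l) :
    is_summand G (H \oo F) -> leL (OneMor F) (OneMor G).
Inductive leJ : onemor -> onemor -> Prop :=
  LeJ i j l m (F : cell i j) (G : cell l m) (H : cell j m) (H' : cell l i) :
    is_summand G ((H \oo F) \oo H') -> leJ (OneMor F) (OneMor G).

Definition is_cell (le : onemor -> onemor -> Prop) (K : onemor -> Prop) : Prop :=
  exists F : onemor, indecomposable F /\
    forall G : onemor, K G <-> [/\ indecomposable G, le F G & le G F].
Definition left_cell := is_cell leL.
Definition two_sided_cell := is_cell leJ.

(* [in2 i j F G] is the subspace Hom_I(F,G) of Hom_{C(i,j)}(F,G). *)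
Record ideal2 := Ideal2 {
  in2 :> forall (i j : obj C) (F G : cell i j), submod (hom F G);
  in2_compl : forall (i j : obj C) (F G H : cell i j) (b : hom G H) (a : hom F G),
    in2 F G a -> in2 F H (b \o1 a);
  in2_compr : forall (i j : obj C) (F G H : cell i j) (b : hom G H) (a : hom F G),
    in2 G H b -> in2 F H (b \o1 a);
  in2_cmp2l : forall (i j l : obj C) (G G' : cell j l) (F F' : cell i j)
      (b : hom G G') (a : hom F F'), in2 F F' a -> in2 _ _ (b \o0 a);
  in2_cmp2r : forall (i j l : obj C) (G G' : cell j l) (F F' : cell i j)
      (b : hom G G') (a : hom F F'), in2 G G' b -> in2 _ _ (b \o0 a) }.

End Fiat.

Arguments OneMor {k C src tgt} mor.
Arguments leL {k C}.
Arguments leJ {k C}.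

(* The first conjunct says that the cell J is non-zero in A. *)
Definition J_simple k (A : lin2Cat k) (J : onemor A -> Prop) : Prop :=
  (forall F : onemor A, J F -> idm (F : cell _ _) <> 0) /\
  forall I : ideal2 A,
    (exists (i j : obj A) (F G : cell i j) (a : hom F G), I i j F G a /\ a <> 0) ->
    exists F : onemor A, J F /\ I _ _ F F (idm (F : cell _ _)).

(* Strict 2-functors from C to k-linear categories, k-linear functors and
   natural transformations. *)
Record twoRep k (C : lin2Cat k) := TwoRep {
  rob : obj C -> linCat k;
  rfun : forall i j, cell i j -> linFun (rob i) (rob j);
  rnat : forall i j (F G : cell i j), hom F G ->
    forall X : rob i, hom (rfun F X) (rfun G X);
  rnat_nat : forall i j (F G : cell i j) (a : hom F G) (X Y : rob i) (f : hom X Y),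
    rnat a Y \o1 fmor (rfun F) f = fmor (rfun G) f \o1 rnat a X;
  rnat_id : forall i j (F : cell i j) (X : rob i),
    rnat (idm F) X = idm (rfun F X);
  rnat_comp : forall i j (F G H : cell i j) (b : hom G H) (a : hom F G) (X : rob i),
    rnat (b \o1 a) X = rnat b X \o1 rnat a X;
  rnat_lin : forall i j (F G : cell i j) (X : rob i),
    linear (fun a : hom F G => rnat a X);
  rfun1 : forall i (X : rob i), rfun (one i) X = X;
  rfun1m : forall i (X Y : rob i) (f : hom X Y),
    idto (rfun1 Y) \o1 fmor (rfun (one i)) f = f \o1 idto (rfun1 X);
  rfunM : forall i j l (G : cell j l) (F : cell i j) (X : rob i),
    rfun (G \oo F) X = rfun G (rfun F X);
  rfunMm : forall i j l (G : cell j l) (F : cell i j) (X Y : rob i) (f : hom X Y),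
    idto (rfunM G F Y) \o1 fmor (rfun (G \oo F)) f
    = fmor (rfun G) (fmor (rfun F) f) \o1 idto (rfunM G F X);
  rnatM : forall i j l (G G' : cell j l) (F F' : cell i j)
      (b : hom G G') (a : hom F F') (X : rob i),
    idto (rfunM G' F' X) \o1 rnat (b \o0 a) X
    = rnat b (rfun F' X) \o1 fmor (rfun G) (rnat a X) \o1 idto (rfunM G F X) }.

Arguments rob {k C} t i : rename.
Arguments rfun {k C} t {i j} F : rename.
Arguments rnat {k C} t {i j F G} a X : rename.
Arguments rfun1 {k C} t {i} X : rename.
Arguments rfunM {k C} t {i j l} G F X : rename.
Arguments rnat_lin {k C} t {i j F G} X a x y : rename.

Section Kernel.
Variables (k : fieldType) (C : lin2Cat k) (M : twoRep C).

Lemma rnat0 (i j : obj C) (F G : cell i j) X : rnat M (0 : hom F G) X = 0.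
Proof.
have := rnat_lin M (F := F) (G := G) X (-1) 0 0.
by rewrite scaler0 addr0 scaleN1r addNr.
Qed.

Definition ker_in (i j : obj C) (F G : cell i j) (a : hom F G) : Prop :=
  forall X : rob M i, rnat M a X = 0.
Lemma ker_in0 (i j : obj C) (F G : cell i j) : ker_in (0 : hom F G).
Proof. by move=> X; exact: rnat0. Qed.
Lemma ker_inP (i j : obj C) (F G : cell i j) (c : k) (a b : hom F G) :
  ker_in a -> ker_in b -> ker_in (c *: a + b).
Proof. by move=> a0 b0 X; rewrite rnat_lin a0 b0 scaler0 addr0. Qed.
Definition ker_submod (i j : obj C) (F G : cell i j) : submod (hom F G) :=
  Submod (@ker_in0 i j F G) (@ker_inP i j F G).

Lemma idtoK (A : linCat k) (X Y Z : A) (e : X = Y) (f g : hom Z X) :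
  idto e \o1 f = idto e \o1 g -> f = g.
Proof. by case: Y / e; rewrite !comp1m. Qed.

Lemma ker_compl (i j : obj C) (F G H : cell i j) (b : hom G H) (a : hom F G) :
  ker_submod F G a -> ker_submod F H (b \o1 a).
Proof. by move=> a0 X; rewrite rnat_comp a0 compm0. Qed.
Lemma ker_compr (i j : obj C) (F G H : cell i j) (b : hom G H) (a : hom F G) :
  ker_submod G H b -> ker_submod F H (b \o1 a).
Proof. by move=> b0 X; rewrite rnat_comp b0 comp0m. Qed.
Lemma ker_cmp2l (i j l : obj C) (G G' : cell j l) (F F' : cell i j)
  (b : hom G G') (a : hom F F') :
  ker_submod F F' a -> ker_submod _ _ (b \o0 a).
Proof.
move=> a0 X; apply: (idtoK (e := rfunM M G' F' X)).
by rewrite rnatM a0 fmor0 !compm0 comp0m.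
Qed.
Lemma ker_cmp2r (i j l : obj C) (G G' : cell j l) (F F' : cell i j)
  (b : hom G G') (a : hom F F') :
  ker_submod G G' b -> ker_submod _ _ (b \o0 a).
Proof.
move=> b0 X; apply: (idtoK (e := rfunM M G' F' X)).
by rewrite rnatM b0 !comp0m compm0.
Qed.

Definition Ker : ideal2 C :=
  Ideal2 ker_compl ker_compr ker_cmp2l ker_cmp2r.
End Kernel.

Section Principal.
Variables (k : fieldType) (C : lin2Cat k) (i : obj C).

Definition postcomp (j l : obj C) (F : cell j l) : linFun (cell i j) (cell i l).
Proof.
refine (@LinFun k (cell i j) (cell i l) (fun X => F \oo X)
  (fun X Y f => idm F \o0 f) _ _ _).
- by move=> X; exact: cmp2_id.
- by move=> X Y Z g f; rewrite -interchange comp1m.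
- by move=> X Y a f g; exact: cmp2_linr.
Defined.

Definition principal : twoRep C.
Proof.
refine (@TwoRep k C (fun j => cell i j) (fun j l F => postcomp F)
  (fun j l F G a X => a \o0 idm X) _ _ _ _
  (fun j X => cmp1_1m X) _ (fun j l m G F X => esym (cmp1A G F X)) _ _) => /=.
- by move=> j l F G a X Y f; rewrite -!interchange !compm1 !comp1m.
- by move=> j l F X; exact: cmp2_id.
- by move=> j l F G H b a X; rewrite -interchange comp1m.
- by move=> j l F G X c a b; exact: cmp2_linl.
- by move=> j X Y f; exact: cmp2_1m.
- move=> j l m G F X Y f.
  have := cmp2A (idm G) (idm F) f; rewrite cmp2_id.
  move: (cmp1A G F X) (cmp1A G F Y) (idm _ \o0 f) (idm G \o0 _).
  case: _ /; case: _ / => /= u v; rewrite !comp1m !compm1; exact: esym.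
- move=> j l m G G' F F' b a X.
  rewrite -interchange comp1m compm1.
  have := cmp2A b a (idm X).
  move: (cmp1A G F X) (cmp1A G' F' X) (_ \o0 idm X) (b \o0 _).
  case: _ /; case: _ / => /= u v; rewrite !comp1m !compm1; exact: esym.
Defined.
End Principal.

(* Morphisms of [abel A] are classes [acls] of commutative squares modulo those
   whose second component factors through the target arrow. *)
Section Abelianization.
Variables (k : fieldType) (A : linCat k).

Record arrow := Arrow { asrc : A; atgt : A; amor : hom asrc atgt }.

Section Hom.
Variables u v : arrow.

Definition pairs : lmodType k := (hom (asrc u) (asrc v) * hom (atgt u) (atgt v))%type.

Definition square_in (p : pairs) : Prop := p.2 \o1 amor u = amor v \o1 p.1.
Lemma square_in0 : square_in 0.
Proof. by rewrite /square_in comp0m compm0. Qed.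
Lemma square_inP a p q : square_in p -> square_in q -> square_in (a *: p + q).
Proof.
rewrite /square_in /= => hp hq.
by rewrite compDl compDr compZl compZr hp hq.
Qed.
Definition square_submod : submod pairs := Submod square_in0 square_inP.
Definition square : lmodType k := subLmod square_submod.

Definition sq1 (s : square) : hom (asrc u) (asrc v) := (val s).1.
Definition sq2 (s : square) : hom (atgt u) (atgt v) := (val s).2.

Definition null_in (s : square) : Prop :=
  exists xi : hom (atgt u) (asrc v), sq2 s = amor v \o1 xi.
Lemma null_in0 : null_in 0.
Proof. by exists 0; rewrite compm0. Qed.
Lemma null_inP a s t : null_in s -> null_in t -> null_in (a *: s + t).
Proof.
move=> [x hx] [y hy]; exists (a *: x + y).
by rewrite /sq2 /= compDr compZr -hx -hy.
Qed.
Definition null_submod : submod square := Submod null_in0 null_inP.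
Definition ahom : lmodType k := quotLmod null_submod.
Definition acls (s : square) : ahom := qpi null_submod s.

Lemma square_eq (s t : square) :
  sq1 s = sq1 t -> sq2 s = sq2 t -> s = t.
Proof. by move=> e1 e2; apply: val_inj; exact: injective_projections. Qed.
Lemma acls_surj (f : ahom) : exists s, f = acls s.
Proof. exact: qpi_surj. Qed.
Lemma acls_eq (s t : square) : acls s = acls t <->
  exists xi : hom (atgt u) (asrc v), sq2 s - sq2 t = amor v \o1 xi.
Proof. exact: qpi_eq. Qed.
Lemma acls_repr (s : square) :
  exists xi : hom (atgt u) (asrc v),
    sq2 (repr (acls s) : square) - sq2 s = amor v \o1 xi.
Proof. exact: (@repr_qpi _ _ null_submod). Qed.
Lemma squareE (s : square) : sq2 s \o1 amor u = amor v \o1 sq1 s.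
Proof. exact: (subLmodP s). Qed.
End Hom.

Definition mkSquare (u v : arrow) (b : hom (asrc u) (asrc v))
    (c : hom (atgt u) (atgt v)) (e : c \o1 amor u = amor v \o1 b) : square u v :=
  @mkSub _ _ (square_submod u v) (b, c) e.

Definition square_id (u : arrow) : square u u :=
  @mkSquare u u (idm _) (idm _) (etrans (comp1m _) (esym (compm1 _))).
Lemma square_comp_subproof (u v w : arrow) (t : square v w) (s : square u v) :
  (sq2 t \o1 sq2 s) \o1 amor u = amor w \o1 (sq1 t \o1 sq1 s).
Proof. by rewrite -compA squareE compA squareE compA. Qed.
Definition square_comp (u v w : arrow) (t : square v w) (s : square u v) :=
  @mkSquare u w _ _ (square_comp_subproof t s).

Definition acomp (u v w : arrow) (g : ahom v w) (f : ahom u v) : ahom u w :=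
  acls (square_comp (repr g : square v w) (repr f : square u v)).
Lemma acompE (u v w : arrow) (t : square v w) (s : square u v) :
  acomp (acls t) (acls s) = acls (square_comp t s).
Proof.
apply/acls_eq.
have [x hx] := acls_repr t; have [y hy] := acls_repr s.
set t' : square v w := repr _ in hx *; set s' : square u v := repr _ in hy *.
exists (x \o1 sq2 s' + sq1 t \o1 y) => /=.
rewrite compDr !compA -squareE -hx -compA -hy compBl compBr.
by rewrite addrA subrK.
Qed.

Definition abel : linCat k.
Proof.
refine (@LinCat k arrow ahom (fun u => acls (square_id u)) acomp _ _ _ _ _).
- move=> u v w x h g f.
  have [h' ->] := acls_surj h; have [g' ->] := acls_surj g.
  have [f' ->] := acls_surj f; rewrite !acompE; congr acls.
  by apply: square_eq; rewrite /sq1 /sq2 /= compA.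
- move=> u v f; have [f' ->] := acls_surj f; rewrite acompE; congr acls.
  by apply: square_eq; rewrite /sq1 /sq2 /= comp1m.
- move=> u v f; have [f' ->] := acls_surj f; rewrite acompE; congr acls.
  by apply: square_eq; rewrite /sq1 /sq2 /= compm1.
- move=> u v w f a g h.
  have [h' ->] := acls_surj h; have [g' ->] := acls_surj g.
  have [f' ->] := acls_surj f; rewrite -linearP !acompE -linearP; congr acls.
  by apply: square_eq; rewrite /sq1 /sq2 /= compDl compZl.
- move=> u v w f a g h.
  have [h' ->] := acls_surj h; have [g' ->] := acls_surj g.
  have [f' ->] := acls_surj f; rewrite -linearP !acompE -linearP; congr acls.
  by apply: square_eq; rewrite /sq1 /sq2 /= compDr compZr.
Defined.
End Abelianization.

Section AbelFunctor.
Variable k : fieldType.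

Section Functor.
Variables (A B : linCat k) (F : linFun A B).

Definition arrow_map (u : arrow A) : arrow B := Arrow (fmor F (amor u)).
Lemma square_map_subproof (u v : arrow A) (s : square u v) :
  fmor F (sq2 s) \o1 amor (arrow_map u)
  = amor (arrow_map v) \o1 fmor F (sq1 s).
Proof. by rewrite /= -!fmorM squareE. Qed.
Definition square_map (u v : arrow A) (s : square u v) :
  square (arrow_map u) (arrow_map v) := @mkSquare k B (arrow_map u) (arrow_map v) _ _ (square_map_subproof s).
Definition amap (u v : arrow A) (f : ahom u v) :
  ahom (arrow_map u) (arrow_map v) := acls (square_map (repr f : square u v)).
Lemma amapE (u v : arrow A) (s : square u v) : amap (acls s) = acls (square_map s).
Proof.
apply/acls_eq; have [x hx] := acls_repr s.
by exists (fmor F x); rewrite /= -fmorB -fmorM -hx.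
Qed.

Definition abel_fun : linFun (abel A) (abel B).
Proof.
refine (@LinFun k (abel A) (abel B) arrow_map amap _ _ _).
- move=> u; rewrite /= amapE; congr acls.
  by apply: square_eq; rewrite /sq1 /sq2 /= fmor1.
- move=> u v w g f; have [g' ->] := acls_surj g; have [f' ->] := acls_surj f.
  rewrite /= acompE !amapE acompE; congr acls.
  by apply: square_eq; rewrite /sq1 /sq2 /= fmorM.
- move=> u v a f g; have [g' ->] := acls_surj g; have [f' ->] := acls_surj f.
  rewrite -linearP !amapE -linearP; congr acls.
  by apply: square_eq; rewrite /sq1 /sq2 /= fmor_lin.
Defined.
End Functor.

Lemma arrow_eq (A : linCat k) (X Y X' Y' : A) (a : hom X Y) (a' : hom X' Y')
  (e1 : X = X') (e2 : Y = Y') :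
  idto e2 \o1 a = a' \o1 idto e1 -> Arrow a = Arrow a'.
Proof. by case: X' / e1 a'; case: Y' / e2 => a'; rewrite comp1m compm1 => ->. Qed.

Lemma idto_arrow (A : linCat k) (u v : abel A) (e1 : asrc u = asrc v)
  (e2 : atgt u = atgt v) (h : idto e2 \o1 amor u = amor v \o1 idto e1)
  (e : u = v) : idto e = acls (mkSquare h).
Proof.
case: v / e e1 e2 h => e1 e2 h; rewrite /=; congr acls.
by apply: square_eq; rewrite /sq1 /sq2 /= idto1.
Qed.

Section Rep.
Variables (C : lin2Cat k) (M : twoRep C).

Lemma abel_nat_subproof (i j : obj C) (F G : cell i j) (a : hom F G)
  (u : arrow (rob M i)) :
  rnat M a (atgt u) \o1 amor (arrow_map (rfun M F) u)
  = amor (arrow_map (rfun M G) u) \o1 rnat M a (asrc u).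
Proof. exact: rnat_nat. Qed.
Definition abel_nat (i j : obj C) (F G : cell i j) (a : hom F G)
    (u : arrow (rob M i)) :
    ahom (arrow_map (rfun M F) u) (arrow_map (rfun M G) u) :=
  acls (@mkSquare k (rob M j) (arrow_map (rfun M F) u) (arrow_map (rfun M G) u)
    _ _ (abel_nat_subproof a u)).

Lemma abel_rfun1 (i : obj C) (u : arrow (rob M i)) :
  arrow_map (rfun M (one i)) u = u.
Proof. by case: u => X Y f; apply: (arrow_eq (rfun1m f)). Qed.
Lemma abel_rfunM (i j l : obj C) (G : cell j l) (F : cell i j)
  (u : arrow (rob M i)) :
  arrow_map (rfun M (G \oo F)) u = arrow_map (rfun M G) (arrow_map (rfun M F) u).
Proof. by case: u => X Y f; apply: (arrow_eq (rfunMm G F f)). Qed.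

Definition abel_rep : twoRep C.
Proof.
refine (@TwoRep k C (fun i => abel (rob M i)) (fun i j F => abel_fun (rfun M F))
  abel_nat _ _ _ _ abel_rfun1 _ abel_rfunM _ _).
- move=> i j F G a u v f; have [s ->] := acls_surj f.
  rewrite /= !amapE !acompE; congr acls.
  by apply: square_eq; rewrite /sq1 /sq2 /= rnat_nat.
- move=> i j F u; rewrite /=; congr acls.
  by apply: square_eq; rewrite /sq1 /sq2 /= rnat_id.
- move=> i j F G H b a u; rewrite /= /abel_nat acompE; congr acls.
  by apply: square_eq; rewrite /sq1 /sq2 /= rnat_comp.
- move=> i j F G u c a b; rewrite /abel_nat -linearP; congr acls.
  by apply: square_eq; rewrite /sq1 /sq2 /= rnat_lin.
- move=> i u v f; have [s ->] := acls_surj f.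
  rewrite (@idto_arrow _ (arrow_map (rfun M (one i)) u) u _ _ (rfun1m (amor u))) (@idto_arrow _ (arrow_map (rfun M (one i)) v) v _ _ (rfun1m (amor v))).
  rewrite /= amapE !acompE; congr acls.
  by apply: square_eq; rewrite /sq1 /sq2 /= rfun1m.
- move=> i j l G F u v f; have [s ->] := acls_surj f.
  rewrite (@idto_arrow _ (arrow_map (rfun M (G \oo F)) u)
    (arrow_map (rfun M G) (arrow_map (rfun M F) u)) _ _ (rfunMm G F (amor u))) (@idto_arrow _ (arrow_map (rfun M (G \oo F)) v)
    (arrow_map (rfun M G) (arrow_map (rfun M F) v)) _ _ (rfunMm G F (amor v))).
  rewrite /= !amapE !acompE; congr acls.
  by apply: square_eq; rewrite /sq1 /sq2 /= rfunMm.
- move=> i j l G G' F F' b a u.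
  rewrite (@idto_arrow _ (arrow_map (rfun M (G \oo F)) u)
    (arrow_map (rfun M G) (arrow_map (rfun M F) u)) _ _ (rfunMm G F (amor u))) (@idto_arrow _ (arrow_map (rfun M (G' \oo F')) u)
    (arrow_map (rfun M G') (arrow_map (rfun M F') u)) _ _ (rfunMm G' F' (amor u))).
  rewrite /= /abel_nat amapE !acompE; congr acls.
  by apply: square_eq; rewrite /sq1 /sq2 /= rnatM.
Defined.
End Rep.
End AbelFunctor.

Section SubRep.
Variables (k : fieldType).

Definition full_sub (A : linCat k) (P : A -> Prop) : linCat k :=
  @LinCat k {X : A | P X} (fun X Y => hom (sval X) (sval Y))
    (fun X => idm (sval X)) (fun X Y Z g f => g \o1 f)
    (fun W X Y Z => @compA k A _ _ _ _) (fun X Y => @comp1m k A _ _)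
    (fun X Y => @compm1 k A _ _) (fun X Y Z => @comp_linl k A _ _ _)
    (fun X Y Z => @comp_linr k A _ _ _).

Lemma idto_full_sub (A : linCat k) (P : A -> Prop) (X Y : full_sub P) (e : X = Y)
  (e' : sval X = sval Y) : (idto e : hom (sval X) (sval Y)) = idto e'.
Proof. by case: Y / e e' => e'; rewrite [RHS]idto1. Qed.

Lemma sval_eq (T : Type) (P : T -> Prop) (X Y : {x | P x}) :
  sval X = sval Y -> X = Y.
Proof.
case: X Y => [x px] [y py] /= e; case: y / e py => py.
by rewrite (Prop_irrelevance px py).
Qed.

Variables (C : lin2Cat k) (M : twoRep C) (P : forall j, rob M j -> Prop).
Hypothesis stable : forall i j (F : cell i j) X, P X -> P (rfun M F X).

Definition sub_fun (i j : obj C) (F : cell i j) :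
  linFun (full_sub (@P i)) (full_sub (@P j)) :=
  @LinFun k (full_sub (@P i)) (full_sub (@P j))
    (fun X => exist (@P j) (rfun M F (sval X)) (stable F (svalP X)))
    (fun X Y f => fmor (rfun M F) f)
    (fun X => fmor1 (rfun M F) _) (fun X Y Z => @fmorM k _ _ (rfun M F) _ _ _)
    (fun X Y => @fmor_lin k _ _ (rfun M F) _ _).

Definition sub_rep : twoRep C.
Proof.
refine (@TwoRep k C (fun j => full_sub (@P j)) sub_fun
  (fun i j F G a X => rnat M a (sval X)) _ _ _ _
  (fun i X => sval_eq (rfun1 M (sval X) : sval (sub_fun _ X) = sval X)) _
  (fun i j l G F X => sval_eq (rfunM M G F (sval X)
     : sval (sub_fun _ X) = sval (sub_fun _ (sub_fun _ X)))) _ _).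
- by move=> i j F G a X Y f; exact: rnat_nat.
- by move=> i j F X; exact: rnat_id.
- by move=> i j F G H b a X; exact: rnat_comp.
- by move=> i j F G X; exact: rnat_lin.
- move=> i X Y f.
  rewrite (@idto_full_sub _ _ (sub_fun (one i) X) X _ (rfun1 M (sval X))) (@idto_full_sub _ _ (sub_fun (one i) Y) Y _ (rfun1 M (sval Y))).
  exact: rfun1m.
- move=> i j l G F X Y f.
  rewrite (@idto_full_sub _ _ (sub_fun (G \oo F) X)
    (sub_fun G (sub_fun F X)) _ (rfunM M G F (sval X))).
  rewrite (@idto_full_sub _ _ (sub_fun (G \oo F) Y)
    (sub_fun G (sub_fun F Y)) _ (rfunM M G F (sval Y))).
  exact: rfunMm.
- move=> i j l G G' F F' b a X.
  rewrite (@idto_full_sub _ _ (sub_fun (G \oo F) X)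
    (sub_fun G (sub_fun F X)) _ (rfunM M G F (sval X))).
  rewrite (@idto_full_sub _ _ (sub_fun (G' \oo F') X)
    (sub_fun G' (sub_fun F' X)) _ (rfunM M G' F' (sval X))).
  exact: rnatM.
Defined.
End SubRep.

Section Generated.
Variables (k : fieldType) (C : lin2Cat k) (M : twoRep C) (i : obj C) (Q : rob M i).

Definition orbit (j : obj C) (X : rob M j) : Prop :=
  exists F : cell i j, X = rfun M F Q.
Lemma orbit_stable (j l : obj C) (F : cell j l) (X : rob M j) :
  additive_closure (@orbit j) X -> additive_closure (@orbit l) (rfun M F X).
Proof.
elim=> {X} [X [G ->]|X /(fun_zero (rfun M F))|X Y Z _ hX _ hY|X Z _ hZ [Y]].
- by apply: ac_in; exists (F \oo G); rewrite rfunM.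
- exact: ac_zero.
- by move/(fun_biproduct (rfun M F)); exact: ac_sum.
- by move/(fun_biproduct (rfun M F)) => h; apply: ac_summand hZ _; exists (rfun M F Y).
Qed.
(* j |-> the additive closure in M(j) of all F Q, with F in C(i,j). *)
Definition add_rep : twoRep C := sub_rep orbit_stable.
End Generated.

Section Quotient.
Variables (k : fieldType) (C : lin2Cat k) (I : ideal2 C).

Section QCat.
Variables i j : obj C.
Definition qhom (F G : cell i j) : lmodType k := quotLmod (I i j F G).
Definition qcls (F G : cell i j) (a : hom F G) : qhom F G := qpi (I i j F G) a.
Lemma qcls_surj (F G : cell i j) (a : qhom F G) : exists b, a = qcls b.
Proof. exact: qpi_surj. Qed.
Definition qcomp (F G H : cell i j) (b : qhom G H) (a : qhom F G) : qhom F H :=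
  qcls ((repr b : hom G H) \o1 (repr a : hom F G)).
Lemma qcompE (F G H : cell i j) (b : hom G H) (a : hom F G) :
  qcomp (qcls b) (qcls a) = qcls (b \o1 a).
Proof.
apply/qpi_eq; set b' := repr _; set a' := repr _.
have -> : (b' : hom G H) \o1 (a' : hom F G) - b \o1 a
    = (b' - b) \o1 a' + b \o1 (a' - a) by rewrite compBl compBr addrA subrK.
apply: inSD.
- by apply: in2_compr; exact: (@repr_qpi _ _ (I i j G H)).
- by apply: in2_compl; exact: (@repr_qpi _ _ (I i j F G)).
Qed.
Definition qcell : linCat k.
Proof.
refine (@LinCat k (cell i j) qhom (fun F => qcls (idm F)) qcomp _ _ _ _ _).
- move=> u v w x h g f.
  have [h' ->] := qcls_surj h; have [g' ->] := qcls_surj g.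
  by have [f' ->] := qcls_surj f; rewrite !qcompE compA.
- by move=> u v f; have [f' ->] := qcls_surj f; rewrite qcompE comp1m.
- by move=> u v f; have [f' ->] := qcls_surj f; rewrite qcompE compm1.
- move=> u v w f a g h.
  have [h' ->] := qcls_surj h; have [g' ->] := qcls_surj g.
  have [f' ->] := qcls_surj f; rewrite -linearP !qcompE -linearP.
  by rewrite compDl compZl.
- move=> u v w f a g h.
  have [h' ->] := qcls_surj h; have [g' ->] := qcls_surj g.
  have [f' ->] := qcls_surj f; rewrite -linearP !qcompE -linearP.
  by rewrite compDr compZr.
Defined.
Lemma idto_qcell (F G : cell i j) (e : F = G) :
  @idto k qcell F G e = qcls (idto e).
Proof. by case: G / e. Qed.
End QCat.

Lemma cmp2Dl (i j l : obj C) (G G' : cell j l) (F F' : cell i j)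
  (b b' : hom G G') (a : hom F F') : (b + b') \o0 a = b \o0 a + b' \o0 a.
Proof. by have /= := cmp2_linl a 1 b b'; rewrite !scale1r. Qed.
Lemma cmp2Dr (i j l : obj C) (G G' : cell j l) (F F' : cell i j)
  (b : hom G G') (a a' : hom F F') : b \o0 (a + a') = b \o0 a + b \o0 a'.
Proof. by have /= := cmp2_linr b 1 a a'; rewrite !scale1r. Qed.

Lemma cmp2_sub (i j l : obj C) (G G' : cell j l) (F F' : cell i j)
  (b b' : hom G G') (a a' : hom F F') :
  b' \o0 a' - b \o0 a = (b' - b) \o0 a' + b \o0 (a' - a).
Proof.
apply/eqP; rewrite subr_eq -addrA -cmp2Dr subrK -cmp2Dl subrK; exact: eqxx.
Qed.

Definition qcmp2 (i j l : obj C) (G G' : qcell j l) (F F' : qcell i j)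
    (b : hom G G') (a : hom F F') : qhom (cmp1 (G : cell j l) (F : cell i j)) (cmp1 G' F') :=
  qcls ((repr b : @hom k (cell j l) G G') \o0 (repr a : @hom k (cell i j) F F')).
Lemma qcmp2E (i j l : obj C) (G G' : cell j l) (F F' : cell i j)
  (b : hom G G') (a : hom F F') : qcmp2 (qcls b) (qcls a) = qcls (b \o0 a).
Proof.
apply/qpi_eq; set b' := repr _; set a' := repr _.
have hb : I _ _ G G' (b' - b) := @repr_qpi _ _ (I j l G G') b.
have ha : I _ _ F F' (a' - a) := @repr_qpi _ _ (I i j F F') a.
rewrite cmp2_sub.
by apply: inSD; [exact: in2_cmp2r | exact: in2_cmp2l].
Qed.

Definition quot2 : lin2Cat k.
Proof.
refine (@Lin2Cat k (obj C) qcell (@one k C) (fun i j l G F => cmp1 G F) qcmp2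
  _ _ _ _ (@cmp1A k C) (@cmp1_1m k C) (@cmp1_m1 k C) _ _ _).
- by move=> i j l G F; rewrite /= qcmp2E cmp2_id.
- move=> i j l G G' G'' F F' F'' b' b a' a.
  have [b1 ->] := qcls_surj b'; have [b2 ->] := qcls_surj b.
  have [a1 ->] := qcls_surj a'; have [a2 ->] := qcls_surj a.
  by rewrite /= (qcmp2E b1 a1) (qcmp2E b2 a2) !qcompE qcmp2E interchange.
- move=> i j l G G' F F' a c b b'.
  have [a1 ->] := qcls_surj a; have [b1 ->] := qcls_surj b.
  have [b2 ->] := qcls_surj b'.
  by rewrite -linearP !qcmp2E -linearP cmp2_linl.
- move=> i j l G G' F F' b c a a'.
  have [b1 ->] := qcls_surj b; have [a1 ->] := qcls_surj a.
  have [a2 ->] := qcls_surj a'.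
  by rewrite -linearP !qcmp2E -linearP cmp2_linr.
- move=> i j l m H H' G G' F F' c b a.
  have [c1 ->] := qcls_surj c; have [b1 ->] := qcls_surj b.
  have [a1 ->] := qcls_surj a.
  by rewrite !idto_qcell !qcmp2E /= !qcompE cmp2A.
- move=> i j F F' a; have [a1 ->] := qcls_surj a.
  by rewrite !idto_qcell /= !qcmp2E !qcompE cmp2_1m.
- move=> i j F F' a; have [a1 ->] := qcls_surj a.
  by rewrite !idto_qcell /= !qcmp2E !qcompE cmp2_m1.
Defined.

Definition quot_mor (F : onemor C) : onemor quot2 :=
  @OneMor k quot2 (src F) (tgt F) (mor F).
Definition image_of (J : onemor C -> Prop) (F : onemor quot2) : Prop :=
  exists F0 : onemor C, J F0 /\ F = quot_mor F0.
End Quotient.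

Section Cell2Representations.
Variables (k : fieldType) (C : lin2Cat k) (hC : fiat C).

Definition Pbar (i : obj C) : twoRep C := abel_rep (principal i).

(* The indecomposable projective P_F = (0 -> F). *)
Definition proj_ob (i j : obj C) (F : cell i j) : rob (Pbar i) j :=
  Arrow (0 : hom (zero_ob (fiat_zero hC i j)) F).

(* [is_duflo L G LG]: G is the Duflo involution of the left cell L and LG is
   its simple top L_G, which is only determined up to isomorphism.  Since L
   contains G, the object i is the common source of the elements of L. *)
Section Duflo.
Variables (L : onemor C -> Prop) (i : obj C) (G : cell i i) (LG : rob (Pbar i) i).

Definition duflo_quotient (N : rob (Pbar i) i) (p : hom (proj_ob (one i)) N) : Prop :=
  is_epi p /\
  exists s : hom LG N, is_socle s /\
    exists (K : rob (Pbar i) i) (c : hom N K), is_cokernel s c /\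
      forall (j : obj C) (F : cell i j), L (OneMor F) -> is_zero (rfun (Pbar i) F K).

Definition is_duflo : Prop :=
  [/\ L (OneMor G), simple_top (proj_ob G) LG &
    exists (N : rob (Pbar i) i) (p : hom (proj_ob (one i)) N),
      duflo_quotient p /\
      forall (N' : rob (Pbar i) i) (p' : hom (proj_ob (one i)) N'),
        duflo_quotient p' ->
        exists u : hom N N', is_iso u /\ u \o1 p = p' ].
End Duflo.

Definition cell_rep (i : obj C) (G : cell i i) (LG : rob (Pbar i) i) : twoRep C :=
  add_rep (rfun (Pbar i) G LG : rob (Pbar i) i).
End Cell2Representations.

Arguments proj_ob {k C} hC {i j} F.
Arguments is_duflo {k C} hC L {i} G LG.
Arguments cell_rep {k C i} G LG.
Arguments image_of {k C} I J F.
Arguments J_simple {k} A J.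

(* Main.v *)
From mathcomp Require Import all_boot all_algebra.
From mathcomp Require Import boolp.
Require Import Defs.

(** The quotient is J-simple because the Duflo involution G is detected by its
    own simple top L_G, and every ideal acting non-trivially reaches id_G.

    Write P for the projective of the identity 1-morphism, P_F for that of F,
    p : P ->> N for the defining quotient and s : L_G -> N for its socle, so
    that N / L_G is killed by the left cell.  A 1-morphism F with F (N / L_G) = 0
    turns s into an isomorphism F L_G = F N, so that F L_G becomes a quotient of
    F P = P_F.  This applies to all 1-morphisms H G ([socle_covers]).

    G L_G is non-zero ([duflo_nonzero]).  Lift P_G ->> L_G -> N along p to
    f : G -> 1; if G N were 0, naturality of f would give p f = f_N (G p) = 0,
    although p f is the non-zero map P_G ->> L_G -> N ([duflo_acts]).  Hence no
    id_F with F in J lies in the kernel.  Otherwise id_G would lie there, and so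
    would the identity of the adjoint G*, a retract of G* G G*; now G* G L_G = 0
    gives G G* G L_G = 0, and G is a retract of G G* G.

    Let an ideal contain a 2-morphism that acts non-trivially on some H G L_G.
    Whiskering it gives b : B -> B' in the ideal, with B' = F' H G, acting
    non-trivially on L_G.  Since B P ->> B N is surjective and B' L_G = B' N, the
    composite P_B -> P_B' ->> B' N = B' L_G is non-zero.  Transposing b along the
    left adjoint B'' of B' yields b^ : B'' B -> 1 in the ideal whose composite
    with p is a non-zero map P_{B'' B} -> L_G followed by s.  As L_G is simple,
    that map is surjective, so the projective P_G maps to L_G through it: the
    ideal contains f : G -> 1 with p f = s t, where t : P_G ->> L_G
    ([ideal_duflo]).  Applying G, the composite P_{G G} -> P_G ->> G N is again
    surjective, so P_G ->> G N is unchanged by some endomorphism e of G in the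
    ideal ([ideal_endo]).  By Fitting's lemma e is invertible or nilpotent, and
    nilpotency would force G N = 0; so e is invertible and id_G lies in the
    ideal ([ideal_contains_duflo]).

    All of this is carried out on elements, that is, on 2-morphisms V -> Y
    modulo those factoring through X -> Y.  The substantial input on the
    abelianization is that a non-zero map from a projective to a simple object
    is surjective ([simple_through]); it needs images, hence weak kernels
    ([weak_kernel]) in categories with finitely many indecomposables. *)

Set Implicit Arguments.
Unset Strict Implicit.
Unset Printing Implicit Defensive.
Import GRing.Theory.
Local Open Scope ring_scope.

(** * Finite-dimensional spaces and endomorphisms of indecomposables *)

Section FiniteDimension.
Variables (k : fieldType) (V : lmodType k).

Lemma submod_sum (S : submod V) (I : finType) (P : pred I) (F : I -> V) :
  (forall a, P a -> S (F a)) -> S (\sum_(a | P a) F a).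
Proof. by move=> SF; elim/big_ind: _ => //; [exact: inS0 | exact: inSD]. Qed.

(** In terms of n spanning vectors, the n + 1 vectors v_0, ..., v_n have an
    (n + 1) x n coordinate matrix, whose rows are linearly dependent. *)
Lemma fin_dim_dependent (v : nat -> V) : fin_dim V ->
  exists (n : nat) (c : 'I_n -> k),
    \sum_(a < n) c a *: v a = 0 /\ exists a, c a != 0.
Proof.
case=> n [e gen].
pose M := \matrix_(a < n.+1, b < n) (projT1 (cid (gen (v a)))) b.
have vE (a : 'I_n.+1) : v a = \sum_(b < n) M a b *: e b.
  rewrite {1}(projT2 (cid (gen (v a)))).
  by apply: eq_bigr => b _; rewrite mxE.
have /rowV0Pn[c /sub_kermxP cM c0] : kermx M != 0.
  rewrite -mxrank_eq0 mxrank_ker -lt0n subn_gt0.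
  exact: leq_ltn_trans (rank_leq_col _) _.
exists n.+1, (c 0); split.
  under eq_bigr => a _ do rewrite vE scaler_sumr.
  rewrite exchange_big big1 //= => b _.
  under eq_bigr => a _ do rewrite scalerA.
  rewrite -scaler_suml.
  by have /matrixP/(_ 0 b) := cM; rewrite !mxE => ->; rewrite scale0r.
by case/rV0Pn: c0 => a ca; exists a.
Qed.

(** The noetherian property of a finite-dimensional space.  Pull the members of
    the family back along a surjection from k^n: a member containing a subspace
    of the largest possible dimension is maximal. *)
Lemma fin_dim_max (Fam : submod V -> Prop) (S0 : submod V) :
  fin_dim V -> Fam S0 ->
  exists S, Fam S /\
    forall S', Fam S' -> (forall x, S x -> S' x) -> forall x, S' x -> S x.
Proof.
case=> n [e gen] F0.
pose phi (c : 'rV[k]_n) := \sum_(a < n) c 0 a *: e a.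
have phiP b c d : phi (b *: c + d) = b *: phi c + phi d.
  rewrite /phi scaler_sumr -big_split; apply: eq_bigr => a _ /=.
  by rewrite !mxE scalerDl scalerA.
have phi_surj x : exists c, x = phi c.
  have [c ->] := gen x; exists (\row_a c a).
  by apply: eq_bigr => a _; rewrite mxE.
pose P d := `[< exists S, Fam S /\ exists U : {vspace 'rV[k]_n},
   (forall u, u \in U -> S (phi u)) /\ \dim U = d >].
have exP : exists d, P d.
  exists 0; apply/asboolP; exists S0; split=> //; exists 0%VS; rewrite dimv0.
  split=> // u; rewrite memv0 => /eqP->.
  have := phiP (-1) 0 0; rewrite scaler0 addr0 scaleN1r addNr => ->.
  exact: inS0.
have ubP d : P d -> (d <= n)%N.
  case/asboolP=> S [_ [U [_ <-]]].
  by have := dimvS (subvf U); rewrite dimvf /dim /= mul1n.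
case: (ex_maxnP exP ubP) => d /asboolP[S [FS [U [US dU]]]] max_d.
exists S; split=> // S' FS' SS' x S'x.
have [c xE] := phi_surj x; rewrite xE in S'x *.
apply/not_notP => nS.
have cU : c \notin U by apply/negP => /US.
have : P d.+1.
  apply/asboolP; exists S'; split=> //; exists (U + <[c]>)%VS; split.
    move=> _ /memv_addP[u Uu [_ /vlineP[b ->] ->]].
    by rewrite addrC phiP; apply: inSP => //; exact/SS'/US.
  rewrite dimv_disjoint_sum ?dU ?dim_vline.
    have -> : c != 0 by apply: contraNneq cU => ->; rewrite mem0v.
    by rewrite addn1.
  apply/eqP; rewrite -subv0; apply/subvP => u /memv_capP[Uu /vlineP[b uE]].
  rewrite memv0 uE scaler_eq0; apply/orP; left; apply: contraR cU => b0.
  by rewrite -[c]scale1r -(mulVf b0) -scalerA -uE rpredZ.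
by move/max_d; rewrite ltnn.
Qed.
End FiniteDimension.

Section Retracts.
Variables (k : fieldType) (A : linCat k).

Lemma is_zero_retract (X Y : A) (i : hom X Y) (r : hom Y X) :
  r \o1 i = idm X -> is_zero Y -> is_zero X.
Proof.
by move=> ri Y0; apply: is_zero_id; rewrite -ri (proj2 (Y0 X) i) compm0.
Qed.

Lemma indecomposable_idempotent (X : A) (e : hom X X) : fully_additive A ->
  indecomposable X -> e \o1 e = e -> e = 0 \/ e = idm X.
Proof.
move=> [_ _ split_id] [_ ind] ee.
have ee' : (idm X - e) \o1 (idm X - e) = idm X - e.
  by rewrite compBl comp1m compBr compm1 ee subrr subr0.
have [Y [r [s [rs sr]]]] := split_id _ _ ee.
have [Z [r' [s' [rs' sr']]]] := split_id _ _ ee'.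
have e0 : e \o1 (idm X - e) = 0 by rewrite compBr compm1 ee subrr.
have e0' : (idm X - e) \o1 e = 0 by rewrite compBl comp1m ee subrr.
case: (ind Y Z).
- exists s, r, s', r'; split=> //.
  + rewrite -[r]comp1m -rs -(compA r) sr -compA -[s']compm1 -rs' (compA s') sr'.
    by rewrite (compA e) e0 comp0m compm0.
  + rewrite -[r']comp1m -rs' -(compA r') sr' -compA -[s]compm1 -rs (compA s) sr.
    by rewrite (compA _ e) e0' comp0m compm0.
  + by rewrite sr sr' addrC subrK.
- by move=> Y0; left; rewrite -sr (proj1 (Y0 X) s) comp0m.
- move=> Z0; right; apply/eqP; rewrite eq_sym -subr_eq0 -sr'.
  by rewrite (proj1 (Z0 X) s') comp0m.
Qed.

Section Fitting.
Variables (X : A) (e : hom X X).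

Definition endo_pow n : hom X X := iter n (comp e) (idm X).

Lemma endo_powD m n : endo_pow (m + n) = endo_pow m \o1 endo_pow n.
Proof. by elim: m => [|m IH]; rewrite ?comp1m // addSn /= IH compA. Qed.

Lemma endo_pow_comm y n :
  y \o1 e = e \o1 y -> y \o1 endo_pow n = endo_pow n \o1 y.
Proof.
move=> ye; elim: n => [|n IH] /=; first by rewrite compm1 comp1m.
by rewrite compA ye -compA IH compA.
Qed.

Lemma fitting_ideal0 m : exists y, y \o1 e = e \o1 y /\ 0 = endo_pow m \o1 y.
Proof. by exists 0; rewrite comp0m !compm0. Qed.
Lemma fitting_idealP m a u v :
  (exists y, y \o1 e = e \o1 y /\ u = endo_pow m \o1 y) ->
  (exists y, y \o1 e = e \o1 y /\ v = endo_pow m \o1 y) ->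
  exists y, y \o1 e = e \o1 y /\ a *: u + v = endo_pow m \o1 y.
Proof.
move=> [y [ye ->]] [z [ze ->]]; exists (a *: y + z).
by rewrite compDl compDr compDr compZl !compZr ye ze.
Qed.
(** The ideal generated by e^m in the centralizer of e; commutation with e is
    what lets e^(m+1) z square to itself in [fitting]. *)
Definition fitting_ideal m := Submod (@fitting_ideal0 m) (@fitting_idealP m).

(** A linear relation among the powers of e, divided by its lowest non-zero
    coefficient, reads e^m = e^(m+1) y with y commuting with e.  Iterating,
    e^m = e^(2m+1) z, so e^(m+1) z is an idempotent; being 0 or 1 it makes e
    nilpotent or invertible. *)
Lemma fitting : fully_additive A -> indecomposable X -> fin_dim (hom X X) ->
  is_iso e \/ exists n, endo_pow n = 0.
Proof.
move=> addA indX fdX.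
have [n [c [c_dep [a0 ca0]]]] := fin_dim_dependent endo_pow fdX.
have [m cm min_m] := @arg_minnP _ a0 (fun a => c a != 0) (@nat_of_ord n) ca0.
have step0 : fitting_ideal m.+1 (endo_pow m).
  rewrite (bigD1 m) //= in c_dep.
  have -> : endo_pow m = - (c m)^-1 *: \sum_(a < n | a != m) c a *: endo_pow a.
    move/eqP: c_dep; rewrite addr_eq0 => /eqP c_dep.
    by rewrite scaleNr -scalerN -c_dep scalerA mulVf // scale1r.
  apply/inSZ/submod_sum => a am.
  case: (eqVneq (c a) 0) => [->|ca]; first by rewrite scale0r; exact: inS0.
  have lt_ma : (m < a)%N by rewrite ltn_neqAle eq_sym am min_m.
  apply: inSZ; exists (endo_pow (a - m.+1)); split.
    by rewrite endo_pow_comm.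
  by rewrite -endo_powD subnKC.
have [y [ye step]] := step0.
have [z [ze eE]] : exists z, z \o1 e = e \o1 z /\
    endo_pow m = endo_pow (m + m.+1) \o1 z.
  elim: (m.+1) => [|r [z [ze IH]]].
    by exists (idm X); rewrite addn0 !comp1m !compm1.
  exists (y \o1 z); split; first by rewrite -compA ze compA ye -compA.
  rewrite {1}IH compA; congr (_ \o1 z).
  rewrite [in LHS]addnC endo_powD {1}step compA -endo_powD.
  by rewrite addnS addnC -addnS.
pose f := endo_pow m.+1 \o1 z.
have ff : f \o1 f = f.
  have zE := endo_pow_comm m.+1 ze.
  have EEz : endo_pow m.+1 \o1 endo_pow m.+1 \o1 z = endo_pow m.+1.
    by rewrite -endo_powD addSn [in RHS]/= eE compA.
  rewrite /f; move: (endo_pow m.+1) zE EEz => E zE EEz.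
  by rewrite compA -(compA E z) zE (compA E E) EEz.
case: (indecomposable_idempotent addA indX ff) => [f0|f1].
- by right; exists m; rewrite eE endo_powD -compA -/f f0 compm0.
- left; exists (endo_pow m \o1 z); split; last by rewrite compA.
  by rewrite -compA ze compA -(endo_pow_comm m (erefl _)).
Qed.
End Fitting.
End Retracts.

(** * Weak kernels in finitary categories *)

Section Through.
Variables (k : fieldType) (A : linCat k).

(** An object l : X -> Y of the abelianization is the cokernel of l, so its maps
    from the projective 0 -> V are the morphisms V -> Y modulo those that
    satisfy [through l]: this predicate says that an element is zero. *)
Definition through (V X Y : A) (l : hom X Y) (y : hom V Y) : Prop :=
  exists x, y = l \o1 x.

Lemma through0 (V X Y : A) (l : hom X Y) : through l (0 : hom V Y).
Proof. by exists 0; rewrite compm0. Qed.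
Lemma throughD (V X Y : A) (l : hom X Y) (y z : hom V Y) :
  through l y -> through l z -> through l (y + z).
Proof. by move=> [u ->] [v ->]; exists (u + v); rewrite compDr. Qed.
Lemma throughN (V X Y : A) (l : hom X Y) (y : hom V Y) :
  through l y -> through l (- y).
Proof. by move=> [u ->]; exists (- u); rewrite -!scaleN1r compZr. Qed.
Lemma throughB (V X Y : A) (l : hom X Y) (y z : hom V Y) :
  through l y -> through l z -> through l (y - z).
Proof. by move=> ly lz; exact/throughD/throughN. Qed.
Lemma through_compr (U V X Y : A) (l : hom X Y) (y : hom V Y) (g : hom U V) :
  through l y -> through l (y \o1 g).
Proof. by move=> [u ->]; exists (u \o1 g); rewrite compA. Qed.
Lemma through_compl (V X Y X' Y' : A) (l : hom X Y) (l' : hom X' Y')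
  (f : hom X X') (g : hom Y Y') (y : hom V Y) :
  g \o1 l = l' \o1 f -> through l y -> through l' (g \o1 y).
Proof. by move=> e [u ->]; exists (f \o1 u); rewrite !compA e. Qed.

Lemma throughP (V X Y : A) (l : hom X Y) a (y z : hom V Y) :
  through l y -> through l z -> through l (a *: y + z).
Proof. by move=> [u ->] [v ->]; exists (a *: u + v); rewrite compDr compZr. Qed.
Definition through_submod (V X Y : A) (l : hom X Y) : submod (hom V Y) :=
  Submod (@through0 V X Y l) (@throughP V X Y l).
End Through.

Section Finitary.
Variables (k : fieldType) (A : linCat k).
Hypothesis addA : fully_additive A.
Hypothesis fdA : forall X Y : A, fin_dim (hom X Y).
Hypothesis indA : fin_indecomposables A.

Lemma left_kernel0 (X Z : A) (p : hom X Z) : p \o1 (0 : hom X X) = 0.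
Proof. exact: compm0. Qed.
Lemma left_kernelP (X Z : A) (p : hom X Z) a (f g : hom X X) :
  p \o1 f = 0 -> p \o1 g = 0 -> p \o1 (a *: f + g) = 0.
Proof. by rewrite compDr compZr => -> ->; rewrite scaler0 addr0. Qed.
Definition left_kernel (X Z : A) (p : hom X Z) :=
  Submod (left_kernel0 p) (left_kernelP (p := p)).

(** Existence of Krull-Schmidt decompositions, as an induction principle.  If
    X were a counterexample, choose a summand Z violating P for which the
    endomorphisms of X killed by the projection onto Z form a maximal subspace.
    Z is neither zero nor indecomposable, and a summand of Z violating P
    contradicts the choice. *)
Lemma krull_schmidt_ind (P : A -> Prop) :
  (forall X, is_zero X -> P X) -> (forall X, indecomposable X -> P X) ->
  (forall X Y Z, is_biproduct X Y Z -> P X -> P Y -> P Z) -> forall X, P X.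
Proof.
move=> P0 Pind Psum X; apply/not_notP => nPX.
pose Fam S := exists Z (i : hom Z X) (p : hom X Z),
  [/\ p \o1 i = idm Z, ~ P Z & S = left_kernel p].
have F0 : Fam (left_kernel (idm X)).
  by exists X, (idm X), (idm X); rewrite comp1m.
have [_ [[Z [i [p [pi nPZ ->]]]] maxZ]] := fin_dim_max (fdA X X) F0.
have nZ0 : ~ is_zero Z by move=> Z0; exact/nPZ/P0.
have step (Y W : A) : is_biproduct Y W Z -> ~ is_zero Y -> ~ P W -> False.
  move=> [i1 [p1 [i2 [p2 [e1 e2 e3 e4 _]]]]] nY0 nPW; apply: nY0.
  have FW : Fam (left_kernel (p2 \o1 p)).
    exists W, (i \o1 i2), (p2 \o1 p); split=> //.
    by rewrite -compA (compA p) pi comp1m.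
  (* the projection of X onto Y lies in the larger subspace, hence in the
     smaller one, which says that it vanishes *)
  have H : p \o1 (i \o1 (i1 \o1 (p1 \o1 p))) = 0.
    apply: (maxZ _ FW) => [x /= px|] /=; first by rewrite -compA px compm0.
    by rewrite -compA (compA p) pi comp1m compA e4 comp0m.
  rewrite compA pi comp1m in H; apply: is_zero_id.
  have -> : idm Y = p1 \o1 (i1 \o1 (p1 \o1 p)) \o1 (i \o1 i1).
    by rewrite (compA p1) e1 comp1m -compA (compA p) pi comp1m e1.
  by rewrite H compm0 comp0m.
have sym (Y W : A) : is_biproduct Y W Z -> is_biproduct W Y Z.
  case=> i1 [p1 [i2 [p2 []]]] *; exists i2, p2, i1, p1.
  by split=> //; rewrite addrC.
apply/nPZ/Pind; split=> // Y W bYW; apply/not_notP => /not_orP[nY nW].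
have [PY|nPY] := pselect (P Y); have [PW|nPW] := pselect (P W).
- exact/nPZ/(Psum _ _ _ bYW).
- exact: (step _ _ bYW).
- exact: (step _ _ (sym _ _ bYW)).
- exact: (step _ _ bYW).
Qed.

Lemma biproduct_exists (X Y : A) : exists (Z : A) (i1 : hom X Z) (i2 : hom Y Z)
  (p1 : hom Z X) (p2 : hom Z Y), [/\ p1 \o1 i1 = idm X, p2 \o1 i2 = idm Y,
    p1 \o1 i2 = 0, p2 \o1 i1 = 0 & i1 \o1 p1 + i2 \o1 p2 = idm Z].
Proof.
have [_ sumA _] := addA.
by have [Z [i1 [p1 [i2 [p2 b]]]]] := sumA X Y; exists Z, i1, i2, p1, p2.
Qed.

(** For one source E, finite-dimensionality lets a morphism R -> Y killed by f
    be chosen with the largest possible image in Hom(E, Y); adding a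
    missed morphism E -> Y to R would enlarge that image.  Summing over the
    finitely many indecomposables E covers all sources. *)
Lemma weak_kernel (Y Z : A) (f : hom Y Z) :
  exists (R : A) (rho : hom R Y), f \o1 rho = 0 /\
    forall V (g : hom V Y), f \o1 g = 0 -> through rho g.
Proof.
have [zA _ _] := addA; have [n [e indE]] := indA.
have one_ob E : exists (R : A) (rho : hom R Y), f \o1 rho = 0 /\
    forall g : hom E Y, f \o1 g = 0 -> through rho g.
  pose Fam (S : submod (hom E Y)) :=
    exists (R : A) (rho : hom R Y), f \o1 rho = 0 /\ S = through_submod E rho.
  have F0 : Fam (through_submod E (0 : hom E Y)) by exists E, 0; rewrite compm0.
  have [_ [[R [rho [frho ->]]] maxR]] := fin_dim_max (fdA E Y) F0.
  exists R, rho; split=> // g fg.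
  have [RE [i1 [i2 [p1 [p2 [e1 e2 e3 e4 _]]]]]] := biproduct_exists R E.
  apply: (maxR (through_submod E (rho \o1 p1 + g \o1 p2))).
  - exists RE, (rho \o1 p1 + g \o1 p2); split=> //.
    by rewrite compDr !compA frho fg !comp0m addr0.
  - move=> _ [h ->]; exists (i1 \o1 h).
    by rewrite compA compDl -!compA e1 e4 compm1 compm0 addr0.
  - by exists i2; rewrite compDl -!compA e2 e3 compm1 compm0 add0r.
have [R [rho [frho cov]]] : exists (R : A) (rho : hom R Y), f \o1 rho = 0 /\
    forall a (g : hom (e a) Y), f \o1 g = 0 -> through rho g.
  suff: exists (R : A) (rho : hom R Y), f \o1 rho = 0 /\
    forall a, a \in enum 'I_n ->
    forall g : hom (e a) Y, f \o1 g = 0 -> through rho g.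
    move=> [R [rho [frho cov]]]; exists R, rho; split=> // a.
    by apply: cov; rewrite mem_enum.
  elim: (enum 'I_n) => [|a s [R [rho [frho cov]]]].
    by exists (zero_ob zA), 0; rewrite compm0.
  have [R' [rho' [frho' cov']]] := one_ob (e a).
  have [RR [i1 [i2 [p1 [p2 [e1 e2 e3 e4 _]]]]]] := biproduct_exists R' R.
  exists RR, (rho' \o1 p1 + rho \o1 p2); split.
    by rewrite compDr !compA frho frho' !comp0m addr0.
  move=> b; rewrite inE => /orP[/eqP -> g /cov'[h ->]|/cov{}cov g /cov[h ->]].
  - exists (i1 \o1 h).
    by rewrite compA compDl -!compA e1 e4 compm1 compm0 addr0.
  - exists (i2 \o1 h).
    by rewrite compA compDl -!compA e2 e3 compm1 compm0 add0r.
exists R, rho; split=> //; apply: krull_schmidt_ind.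
- by move=> V V0 g _; exists 0; rewrite compm0 (proj1 (V0 Y) g).
- move=> V /indE[a [u [v [vu _]]]] g fg.
  have [|h hE] := cov a (g \o1 v); first by rewrite compA fg comp0m.
  by exists (h \o1 u); rewrite compA -hE -compA vu compm1.
- move=> V W U [i1 [p1 [i2 [p2 [_ _ _ _ idU]]]]] covV covW g fg.
  have [|h hE] := covV (g \o1 i1); first by rewrite compA fg comp0m.
  have [|h' hE'] := covW (g \o1 i2); first by rewrite compA fg comp0m.
  exists (h \o1 p1 + h' \o1 p2).
  by rewrite compDr !compA -hE -hE' -!compA -compDr idU compm1.
Qed.

Lemma weak_pullback (X U Y : A) (l : hom X Y) (w : hom U Y) :
  exists (R : A) (r1 : hom R X) (r2 : hom R U), l \o1 r1 = w \o1 r2 /\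
    forall V (g1 : hom V X) (g2 : hom V U), l \o1 g1 = w \o1 g2 ->
      exists h, g1 = r1 \o1 h /\ g2 = r2 \o1 h.
Proof.
have [XU [i1 [i2 [p1 [p2 [e1 e2 e3 e4 _]]]]]] := biproduct_exists X U.
have [R [rho [rho0 cov]]] := weak_kernel (l \o1 p1 - w \o1 p2).
exists R, (p1 \o1 rho), (p2 \o1 rho); split.
  by apply/eqP; rewrite -subr_eq0 !compA -compBl rho0.
move=> V g1 g2 gE.
have [|h hE] := cov V (i1 \o1 g1 + i2 \o1 g2).
  rewrite compDr !compBl -!compA (compA p1) (compA p2) e1 e4.
  rewrite (compA p1) (compA p2) e2 e3 !comp1m !comp0m !compm0 gE subr0 sub0r.
  exact: subrr.
exists h; rewrite -!compA -hE !compDr !compA e1 e2 e3 e4.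
by rewrite !comp1m !comp0m addr0 add0r.
Qed.
End Finitary.

(** * The abelianization in terms of elements *)

Lemma acls0P (k : fieldType) (A : linCat k) (u v : arrow A) (s : square u v) :
  acls s = 0 <-> through (amor v) (sq2 s).
Proof. exact: (qpi0 (null_submod u v) s). Qed.

Section Abelianization.
Variables (k : fieldType) (A : linCat k).
Hypothesis addA : fully_additive A.
Implicit Types u v w : abel A.

Lemma abel_zero u : is_zero u <-> through (amor u) (idm (atgt u)).
Proof.
split=> [u0|h].
- exact: (proj1 (@acls0P _ _ _ _ (square_id u)) (proj1 (u0 u) _)).
- apply: (@is_zero_id k (abel A) u).
  exact: (proj2 (@acls0P _ _ _ _ (square_id u)) h).
Qed.

(** The cokernel of a map given by g : Y -> Y' into the object n : X' -> Y' is
    (n, g) : X' + Y -> Y'.  If a functor F kills the projection onto it, then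
    F n and F g are jointly split onto F Y', the form in which surjectivity is
    used below. *)
Lemma abel_cokernel u v (s : square u v) :
  exists (w : abel A) (q : hom v w), q \o1 (acls s : hom u v) = 0 /\
    forall (B : linCat k) (F : linFun A B), fmor (abel_fun F) q = 0 ->
    exists x y, idm (F (atgt v)) = fmor F (amor v) \o1 x + fmor F (sq2 s) \o1 y.
Proof.
have [Z [i1 [i2 [p1 [p2 [e1 e2 e3 e4 _]]]]]] :=
  biproduct_exists addA (asrc v) (atgt u).
pose w : abel A := Arrow (amor v \o1 p1 + sq2 s \o1 p2).
have qP : idm (atgt v) \o1 amor v = amor w \o1 i1.
  by rewrite comp1m compDl -!compA e1 e4 compm1 compm0 addr0.
exists w, (acls (@mkSquare _ _ v w i1 (idm _) qP)); split.
- rewrite /= acompE; apply/acls0P; exists i2.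
  by rewrite /sq2 /= comp1m compDl -!compA e2 e3 compm1 compm0 add0r.
- move=> B F; rewrite /= amapE => /acls0P[xi].
  rewrite /sq2 /= fmor1 fmorD !fmorM compDl -!compA => ->.
  by exists (fmor F p1 \o1 xi), (fmor F p2 \o1 xi).
Qed.

Definition id_fun : linFun A A.
Proof. by exists id (fun _ _ f => f). Defined.

Lemma epi_through u v (s : square u v) : is_epi (acls s : hom u v) ->
  exists x y, idm (atgt v) = amor v \o1 x + sq2 s \o1 y.
Proof.
move=> epi_s; have [w [q [qs0 q_id]]] := abel_cokernel s.
have q0 : q = 0 by apply: epi_s; rewrite qs0 comp0m.
by apply: (q_id _ id_fun); rewrite q0 fmor0.
Qed.

(** Right exactness of F at s: the explicit cokernel of s receives a map from
    the given one, which F kills. *)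
Lemma cokernel_through u v w (s : square u v) (c : hom v w) (B : linCat k)
  (F : linFun A B) :
  is_cokernel (acls s : hom u v) c -> is_zero (abel_fun F w) ->
  exists x y, idm (F (atgt v)) = fmor F (amor v) \o1 x + fmor F (sq2 s) \o1 y.
Proof.
move=> [_ univ] w0; have [w' [q [qs0 q_id]]] := abel_cokernel s.
have [h [hE _]] := univ _ _ qs0.
by apply: q_id; rewrite -hE fmorM (proj1 (w0 _) (fmor _ h)) comp0m.
Qed.

(** Monomorphisms are injective on elements: test them on 0 -> V. *)
Lemma mono_through u v (s : square u v) (V : A) (y : hom V (atgt u)) :
  is_mono (acls s : hom u v) -> through (amor v) (sq2 s \o1 y) ->
  through (amor u) y.
Proof.
have [zA _ _] := addA; move=> mono_s sy.
pose w : abel A := Arrow (0 : hom (zero_ob zA) V).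
have eP : y \o1 amor w = amor u \o1 0 by rewrite !compm0.
pose g := @mkSquare _ _ w u _ _ eP.
apply/(@acls0P _ _ _ _ g); apply: (mono_s w).
by rewrite compm0 /= acompE; apply/(@acls0P _ _ _ _ (square_comp s g)).
Qed.

Hypothesis fdA : forall X Y : A, fin_dim (hom X Y).
Hypothesis indA : fin_indecomposables A.

(** A non-zero map from the projective of U to a simple object is surjective
    on elements.  Its image is presented by R -> U, with R a weak pullback of w
    along the presentation of u, and embeds into u; by simplicity the
    embedding is zero, contradicting w <> 0, or invertible. *)
Lemma simple_through u (U V : A) (w : hom U (atgt u)) (t : hom V (atgt u)) :
  is_simple u -> ~ through (amor u) w ->
  exists y : hom V U, through (amor u) (t - w \o1 y).
Proof.
move=> [_ simple_u] w_n0.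
have [R [r1 [r2 [rE cov]]]] := weak_pullback addA fdA indA (amor u) w.
pose W : abel A := Arrow r2.
pose m := @mkSquare _ _ W u r1 w (esym rE).
have mono_m : is_mono (acls m : hom W u).
  move=> W' f g mfg; apply/eqP; rewrite -subr_eq0; apply/eqP.
  have : (acls m : hom W u) \o1 (f - g) = 0 by rewrite compBr mfg subrr.
  case: (acls_surj (f - g)) => h ->; rewrite /= acompE => /acls0P[xi].
  rewrite /sq2 /= => /esym/cov[x [_ hE]].
  by apply/acls0P; exists x.
case: (simple_u _ _ mono_m) => [/abel_zero[x /= idU]|[g [_]]].
  by case: w_n0; exists (r1 \o1 x); rewrite compA rE -compA -idU compm1.
case: (acls_surj g) => g' ->; rewrite /= acompE => /acls_eq[xi].
rewrite /sq2 /= => gE; exists (sq2 g' \o1 t); rewrite -opprB; apply: throughN.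
by exists (xi \o1 t); rewrite compA -gE compBl comp1m -compA.
Qed.
End Abelianization.

(** * Adjunctions and kernels of 2-representations *)

Section Idto.
Variables (k : fieldType).
Lemma idto_trans (A : linCat k) (X Y Z : A) (e : X = Y) (e' : Y = Z) :
  idto e' \o1 idto e = idto (etrans e e').
Proof. by case: Z / e'; rewrite comp1m. Qed.
Lemma fmor_idto (A B : linCat k) (F : linFun A B) (X Y : A) (e : X = Y) :
  fmor F (idto e) = idto (congr1 F e).
Proof. by case: Y / e; rewrite fmor1. Qed.
Lemma rnat_idto (C : lin2Cat k) (M : twoRep C) (i j : obj C) (F G : cell i j)
  (e : F = G) (X : rob M i) :
  rnat M (idto e) X = idto (congr1 (fun F => rfun M F X) e).
Proof. by case: G / e; rewrite rnat_id. Qed.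
Lemma idto_eq (A : linCat k) (X Y : A) (e e' : X = Y) : idto e = idto e'.
Proof. by rewrite (Prop_irrelevance e e'). Qed.
End Idto.

Section TwoRep.
Variables (k : fieldType) (C : lin2Cat k) (M : twoRep C).

Lemma rnat_cmp2 (i j l : obj C) (G G' : cell j l) (F F' : cell i j)
  (b : hom G G') (a : hom F F') (X : rob M i) :
  rnat M (b \o0 a) X = idto (esym (rfunM M G' F' X))
   \o1 (rnat M b (rfun M F' X) \o1 fmor (rfun M G) (rnat M a X))
   \o1 idto (rfunM M G F X).
Proof. by rewrite -(compA (idto _)) -rnatM compA idto_trans idto1 comp1m. Qed.

Lemma rfun_zero_retract (i j : obj C) (F G : cell i j)
  (a : hom F G) (b : hom G F) (X : rob M i) :
  b \o1 a = idm F -> is_zero (rfun M G X) -> is_zero (rfun M F X).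
Proof.
move=> ba; apply: (is_zero_retract (i := rnat M a X) (r := rnat M b X)).
by rewrite -rnat_comp ba rnat_id.
Qed.

Lemma rfun_zero_cmp1 (i j l : obj C) (G : cell j l) (F : cell i j)
  (X : rob M i) :
  is_zero (rfun M F X) -> is_zero (rfun M (G \oo F) X).
Proof. by rewrite rfunM; exact: fun_zero. Qed.

(** What an adjunction F' -| F gives for elements: its counit eps transposes
    g : V -> F Y to eps (F' g) : F' V -> Y, naturally in Y, and the transpose
    of an element is zero only if the element is. *)
Definition left_adjoint_data (j l : obj C) (F : cell j l) : Prop :=
  exists (F' : cell l j)
    (eps : forall Y : rob M j, hom (rfun M F' (rfun M F Y)) Y),
  (forall X Y (f : hom X Y),
     eps Y \o1 fmor (rfun M F') (fmor (rfun M F) f) = f \o1 eps X) /\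
  forall V X Y (x : hom X Y) (g : hom V (rfun M F Y)),
    through x (eps Y \o1 fmor (rfun M F') g) -> through (fmor (rfun M F) x) g.

(** The unit and the counit of F' -| F act in every 2-representation, where one
    zig-zag identity becomes a triangle identity; g is recovered from its
    transpose by applying F and composing with the unit. *)
Lemma adjoint_pair_data (j l : obj C) (F' : cell l j) (F : cell j l) :
  adjoint_pair F' F -> left_adjoint_data F.
Proof.
case=> alpha [beta [_ zigzag]].
pose eps (Y : rob M j) : hom (rfun M F' (rfun M F Y)) Y :=
  idto (rfun1 M Y) \o1 rnat M alpha Y \o1 idto (esym (rfunM M F' F Y)).
pose eta (V : rob M l) : hom V (rfun M F (rfun M F' V)) :=
  idto (rfunM M F F' V) \o1 rnat M beta V \o1 idto (esym (rfun1 M V)).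
have idtomV (A : linCat k) (X Y : A) (e : X = Y) :
    idto e \o1 idto (esym e) = idm Y.
  by rewrite idto_trans idto1.
have fmorMV (V W : rob M j) (f : hom V W) :
    idto (esym (rfunM M F' F W)) \o1 fmor (rfun M F') (fmor (rfun M F) f)
    = fmor (rfun M (F' \oo F)) f \o1 idto (esym (rfunM M F' F V)).
  apply: (idtoK (e := rfunM M F' F W)).
  by rewrite !compA idtomV comp1m rfunMm -!compA idtomV compm1.
have fmor1V (V W : rob M l) (f : hom V W) :
    idto (esym (rfun1 M W)) \o1 f
    = fmor (rfun M (one l)) f \o1 idto (esym (rfun1 M V)).
  apply: (idtoK (e := rfun1 M W)).
  by rewrite !compA idtomV comp1m rfun1m -!compA idtomV compm1.
have eps_nat (X Y : rob M j) (f : hom X Y) :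
    eps Y \o1 fmor (rfun M F') (fmor (rfun M F) f) = f \o1 eps X.
  rewrite /eps -!compA fmorMV (compA (rnat _ _ _)) rnat_nat.
  by rewrite -compA compA rfun1m -!compA.
have eta_nat (V W : rob M l) (g : hom V W) :
    eta W \o1 g = fmor (rfun M F) (fmor (rfun M F') g) \o1 eta V.
  rewrite /eta -!compA fmor1V (compA (rnat _ _ _)) rnat_nat.
  by rewrite -compA compA rfunMm -!compA.
have triangle (Y : rob M j) :
    fmor (rfun M F) (eps Y) \o1 eta (rfun M F Y) = idm _.
  have /(congr1 (fun a => rnat M a Y)) := zigzag.
  rewrite rnat_id => <-.
  rewrite !rnat_comp !rnat_cmp2 !rnat_id !rnat_idto fmor1.
  rewrite /eps /eta !fmorM !fmor_idto.
  (* both sides are now the same two 2-morphisms, interleaved with canonical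
     identifications between the same objects *)
  rewrite comp1m compm1 -!compA !(compA (idto _) (idto _)) !idto_trans.
  rewrite !compA -[in RHS](compA _ (idto _) (idto _)) idto_trans.
  by congr (_ \o1 _ \o1 _ \o1 _ \o1 _); exact: idto_eq.
exists F', eps; split=> // V X Y x g [h hE].
exists (fmor (rfun M F) h \o1 eta V).
by rewrite compA -fmorM -hE fmorM -compA -eta_nat compA triangle comp1m.
Qed.

Lemma left_adjoint_iso (j l : obj C) (F F1 : cell j l) :
  isomorphic F1 F -> left_adjoint_data F1 -> left_adjoint_data F.
Proof.
move=> [phi [psi [_ phi_psi]]] [F' [eps [eps_nat eps_inj]]].
exists F', (fun Y => eps Y \o1 fmor (rfun M F') (rnat M psi Y)); split.
- by move=> X Y f; rewrite -compA -fmorM rnat_nat fmorM compA eps_nat compA.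
- move=> V X Y x g; rewrite -compA -fmorM => /eps_inj[h hE].
  exists (rnat M phi X \o1 h).
  rewrite compA -rnat_nat -compA -hE compA -rnat_comp phi_psi rnat_id.
  by rewrite comp1m.
Qed.

(** Every F is isomorphic to F-double-star, which is right adjoint to F*. *)
Lemma fiat_left_adjoint (j l : obj C) (F : cell j l) :
  fiat C -> left_adjoint_data F.
Proof.
move=> hC; have [S adjS] := fiat_star hC.
apply: left_adjoint_iso (adjoint_pair_data (adjS _ _ (S _ _ F))).
have [g [gK Kg]] := st_eta_iso S F.
by exists g, (st_eta S F).
Qed.

(** The objects on which a acts by zero are closed under sums and summands. *)
Lemma ker_add_rep (i : obj C) (Q : rob M i) (j l : obj C) (F G : cell j l)
  (a : hom F G) :
  (forall H : cell i j, rnat M a (rfun M H Q) = 0) -> Ker (add_rep Q) j l F G a.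
Proof.
move=> aQ [X acX]; rewrite /=; elim: acX => {X}.
- by move=> _ [H ->]; exact: aQ.
- move=> X X0; exact: (proj1 (fun_zero (rfun M F) X0 _)).
- move=> X Y Z _ aX _ aY [i1 [p1 [i2 [p2 [_ _ _ _ idZ]]]]].
  rewrite -[rnat M a Z]compm1 -fmor1 -idZ fmorD !fmorM compDr !compA !rnat_nat.
  by rewrite aX aY !compm0 !comp0m addr0.
- move=> X Z _ aZ [Y [i1 [p1 [_ [_ [pi _ _ _ _]]]]]].
  rewrite -[rnat M a X]compm1 -fmor1 -pi fmorM compA rnat_nat aZ.
  by rewrite compm0 comp0m.
Qed.

Lemma rnat_cmp2_id (i j l : obj C) (F G : cell j l) (H : cell i j) (a : hom F G)
  (Q : rob M i) : rnat M (a \o0 idm H) Q = 0 -> rnat M a (rfun M H Q) = 0.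
Proof.
rewrite rnat_cmp2 rnat_id fmor1 compm1 => a0.
have -> : rnat M a (rfun M H Q) = idto (rfunM M G H Q)
    \o1 (idto (esym (rfunM M G H Q)) \o1 rnat M a (rfun M H Q)
          \o1 idto (rfunM M F H Q))
    \o1 idto (esym (rfunM M F H Q)).
  by rewrite !compA idto_trans idto1 comp1m -compA idto_trans idto1 compm1.
by rewrite a0 compm0 comp0m.
Qed.
End TwoRep.

Section Retract.
Variables (k : fieldType) (C : lin2Cat k).

(** The zig-zag identities, bracketed so as to exhibit two retractions. *)
Lemma adjoint_retract (i j : obj C) (F : cell i j) (F' : cell j i) :
  adjoint_pair F F' ->
  (exists (a : hom F (F \oo (F' \oo F))) (b : hom (F \oo (F' \oo F)) F),
     b \o1 a = idm F) /\
  (exists (a : hom F' (F' \oo (F \oo F'))) (b : hom (F' \oo (F \oo F')) F'),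
     b \o1 a = idm F').
Proof.
case=> alpha [beta [zz1 zz2]]; split.
- exists ((idm F \o0 beta) \o1 idto (esym (cmp1_m1 F))).
  exists (idto (cmp1_1m F) \o1 (alpha \o0 idm F) \o1 idto (cmp1A F F' F)).
  by rewrite !compA in zz1 *.
- exists (idto (esym (cmp1A F' F F')) \o1 (beta \o0 idm F')
            \o1 idto (esym (cmp1_1m F'))).
  exists (idto (cmp1_m1 F') \o1 (idm F' \o0 alpha)).
  by rewrite !compA in zz2 *.
Qed.

Lemma ideal_retract (I : ideal2 C) (i j : obj C) (F G : cell i j)
  (a : hom F G) (b : hom G F) :
  b \o1 a = idm F -> I i j G G (idm G) -> I i j F F (idm F).
Proof.
by move=> <- IG; rewrite -[b]compm1; apply: in2_compr; apply: in2_compl.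
Qed.
End Retract.

(** * The Duflo involution generates every ideal that acts non-trivially *)

Section Whiskering.
Variables (k : fieldType) (C : lin2Cat k).

(** The action of F on the morphisms of the principal 2-representation. *)
Definition whisker (i j l : obj C) (F : cell j l) (X Y : cell i j)
  (f : hom X Y) : hom (F \oo X) (F \oo Y) := idm F \o0 f.

Lemma whiskerM (i j l : obj C) (F : cell j l) (X Y Z : cell i j)
  (g : hom Y Z) (f : hom X Y) :
  whisker F (g \o1 f) = whisker F g \o1 whisker F f.
Proof. exact: (fmorM (postcomp i F)). Qed.
Lemma whiskerD (i j l : obj C) (F : cell j l) (X Y : cell i j)
  (g f : hom X Y) : whisker F (g + f) = whisker F g + whisker F f.
Proof. exact: (fmorD (postcomp i F)). Qed.
Lemma whiskerB (i j l : obj C) (F : cell j l) (X Y : cell i j)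
  (g f : hom X Y) : whisker F (g - f) = whisker F g - whisker F f.
Proof. exact: (fmorB (postcomp i F)). Qed.
Lemma whisker1 (i j l : obj C) (F : cell j l) (X : cell i j) :
  whisker F (idm X) = idm (F \oo X).
Proof. exact: cmp2_id. Qed.
Lemma whisker_slide (i j l : obj C) (F G : cell j l) (a : hom F G)
  (X Y : cell i j) (f : hom X Y) :
  (a \o0 idm Y) \o1 whisker F f = whisker G f \o1 (a \o0 idm X).
Proof. exact: (@rnat_nat _ _ (principal i) _ _ F G a X Y f). Qed.
Lemma whisker_through (i j l : obj C) (F : cell j l) (V X Y : cell i j)
  (x : hom X Y) (y : hom V Y) :
  through x y -> through (whisker F x) (whisker F y).
Proof. by move=> [u ->]; exists (whisker F u); rewrite whiskerM. Qed.

Definition runit (i j : obj C) (F : cell i j) : hom F (F \oo one i) :=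
  idto (esym (cmp1_m1 F)).
Definition runitV (i j : obj C) (F : cell i j) : hom (F \oo one i) F :=
  idto (cmp1_m1 F).
Lemma runitK (i j : obj C) (F : cell i j) : runitV F \o1 runit F = idm F.
Proof. by rewrite idto_trans idto1. Qed.
Lemma runitVK (i j : obj C) (F : cell i j) : runit F \o1 runitV F = idm _.
Proof. by rewrite idto_trans idto1. Qed.
Lemma runit_nat (i j : obj C) (F G : cell i j) (a : hom F G) :
  runit G \o1 a = (a \o0 idm (one i)) \o1 runit F.
Proof.
apply: (idtoK (e := cmp1_m1 G)); rewrite !compA cmp2_m1 runitK comp1m.
by rewrite -compA runitK compm1.
Qed.
End Whiskering.

Section Duflo.
(** The data of a Duflo involution on the level of 2-morphisms:
    lam presents L_G, nu presents N, (s1, s2) is the socle L_G -> N, p is the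
    projection onto N and t the top P_G -> L_G. *)
Variables (k : fieldType) (C : lin2Cat k) (hC : fiat C) (i : obj C).
Variables (X0 Y0 X1 Y1 G : cell i i) (lam : hom X0 Y0) (nu : hom X1 Y1).
Variables (s1 : hom X0 X1) (s2 : hom Y0 Y1) (p : hom (one i) Y1) (t : hom G Y0).
Hypothesis sP : s2 \o1 lam = nu \o1 s1.
Hypothesis p_epi : exists x y, idm Y1 = nu \o1 x + p \o1 y.
Hypothesis t_epi : exists x y, idm Y0 = lam \o1 x + t \o1 y.
Hypothesis s_inj : forall (V : cell i i) (y : hom V Y0),
  through nu (s2 \o1 y) -> through lam y.
Hypothesis t_n0 : ~ through lam t.
Hypothesis top_G : forall (U : cell i i) (w : hom U Y0), ~ through lam w ->
  exists y : hom G U, through lam (t - w \o1 y).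

(** F s : F L_G -> F N is surjective, which is what F (N / L_G) = 0 means. *)
Definition socle_covers (j : obj C) (F : cell i j) : Prop :=
  exists x y, idm (F \oo Y1) = whisker F nu \o1 x + whisker F s2 \o1 y.
Hypothesis coverG : socle_covers G.

Lemma whisker_sP (j : obj C) (F : cell i j) :
  whisker F s2 \o1 whisker F lam = whisker F nu \o1 whisker F s1.
Proof. by rewrite -!whiskerM sP. Qed.

(** G p : P_G -> G N is non-zero.  Lifting s t along p gives f : G -> 1 with
    p f <> 0, and p f = f_N (G p) by naturality of the action of f. *)
Lemma duflo_acts : ~ through (whisker G nu) (whisker G p \o1 runit G).
Proof.
have [x [y idY1]] := p_epi; pose f := y \o1 s2 \o1 t.
move=> Gp0; apply/t_n0/s_inj.
have -> : s2 \o1 t = nu \o1 (x \o1 s2 \o1 t) + p \o1 f.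
  by rewrite -{1}[s2]comp1m idY1 !compDl !compA.
apply: throughD; first by exists (x \o1 s2 \o1 t).
have -> : p \o1 f = idto (cmp1_1m Y1) \o1 (f \o0 idm Y1)
    \o1 (whisker G p \o1 runit G).
  rewrite -compA (compA _ (whisker G p)) whisker_slide -compA -runit_nat.
  by rewrite compA compA cmp2_1m -(compA p) idto_trans idto1 compm1.
apply: (through_compl (f := idto (cmp1_1m X1) \o1 (f \o0 idm X1))) Gp0.
by rewrite -compA whisker_slide !compA cmp2_1m.
Qed.

(** G L_G = 0 would give G N = 0, as G s is surjective. *)
Lemma duflo_nonzero : ~ through (whisker G lam) (idm (G \oo Y0)).
Proof.
move=> GY0; apply: duflo_acts.
rewrite -[_ \o1 runit G]comp1m; apply: through_compr.
have [x [y ->]] := coverG; apply: throughD; first by exists x.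
rewrite -[y]comp1m; apply: (through_compl (whisker_sP G)); exact: through_compr.
Qed.

Variable I : ideal2 C.

Lemma ideal_whisker (j l m : obj C) (F : cell l m) (X Y : cell j l)
  (f : hom X Y) :
  I j l X Y f -> I _ _ _ _ (whisker F f).
Proof. exact: in2_cmp2l. Qed.

(** From b acting non-trivially on L_G to a 2-morphism f : G -> 1 of the ideal
    with p f = s t.  The element g of B' N given by b is non-zero and comes from
    B' L_G; transposed along B'' -| B', it shows that p b^ is s applied to a
    non-zero element of L_G, through which t factors. *)
Lemma ideal_duflo (j : obj C) (B B' : cell i j) (b : hom B B') :
  I i j B B' b -> socle_covers B' ->
  ~ through (whisker B' lam) (b \o0 idm Y0) ->
  exists f : hom G (one i),
    I i i G (one i) f /\ through nu (s2 \o1 t - p \o1 f).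
Proof.
move=> Ib [x [y idB'Y1]] b_n0.
have [B'' [eps [eps_nat eps_inj]]] := fiat_left_adjoint (principal i) B' hC.
rewrite /= in eps_nat eps_inj.
pose tau V Y (h : hom V (B' \oo Y)) := eps Y \o1 whisker B'' h.
have tau_nat V X Y (f : hom X Y) (h : hom V (B' \oo X)) :
  tau _ _ (whisker B' f \o1 h) = f \o1 tau _ _ h.
  by rewrite /tau whiskerM compA eps_nat compA.
pose g := whisker B' p \o1 (runit B' \o1 b).
(* g = 0 forces b_N = 0, since B p is surjective, and then b_{L_G} = 0, since
   B' s is injective *)
have g_n0 : ~ through (whisker B' nu) g.
  move=> g0; apply/b_n0/eps_inj/s_inj.
  rewrite -/(whisker B'' _) -/(tau _ _ _) -tau_nat -whisker_slide.
  have [u ->] : through (whisker B' nu) (b \o0 idm Y1).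
    have [x1 [y1 idY1]] := p_epi.
    have idBY1 := whisker1 B Y1; rewrite idY1 whiskerD !whiskerM in idBY1.
    rewrite -[b \o0 _]compm1 -idBY1 compDr.
    apply: throughD.
      rewrite compA whisker_slide -compA.
      by exists ((b \o0 idm X1) \o1 whisker B x1).
    rewrite compA whisker_slide.
    have -> : b \o0 idm (one i) = runit B' \o1 b \o1 runitV B.
      by rewrite runit_nat -compA runitVK compm1.
    by rewrite !compA -(compA _ _ b); do 2!apply: through_compr.
  by rewrite -compA tau_nat; exists (tau _ _ (u \o1 whisker B s2)).
have tau_I : I _ _ _ _ (tau _ _ (runit B' \o1 b)).
  by apply/in2_compl/ideal_whisker/in2_compl.
have gE : g = whisker B' nu \o1 (x \o1 g) + whisker B' s2 \o1 (y \o1 g).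
  by rewrite -{1}[g]comp1m idB'Y1 compDl !compA.
have w_n0 : ~ through lam (tau _ _ (y \o1 g)).
  move=> /eps_inj w0; apply: g_n0; rewrite gE; apply: throughD.
    by exists (x \o1 g).
  exact: through_compl (whisker_sP B') w0.
have [z tz] := top_G w_n0.
exists (tau _ _ (runit B' \o1 b) \o1 z); split; first exact: in2_compr.
have -> : p \o1 (tau _ _ (runit B' \o1 b) \o1 z) =
    nu \o1 (tau _ _ (x \o1 g) \o1 z) + s2 \o1 (tau _ _ (y \o1 g) \o1 z).
  rewrite (compA p) -tau_nat -/g {1}gE /tau whiskerD compDr -/(tau _ _ _).
  by rewrite -/(tau _ _ _) !tau_nat compDl -!(compA _ _ z).
rewrite opprD addrCA addrC -compBr; apply: throughB.
  exact: through_compl sP tz.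
by exists (tau _ _ (x \o1 g) \o1 z).
Qed.

(** G s and G t are surjective, so G p factors through G (p f) = G (s t); the
    factorization P_G -> G P_G followed by G f is the endomorphism e. *)
Lemma ideal_endo (f : hom G (one i)) : I i i G (one i) f ->
  through nu (s2 \o1 t - p \o1 f) ->
  exists e : hom G G, I i i G G e /\
    through (whisker G nu) (whisker G p \o1 runit G \o1 (idm G - e)).
Proof.
move=> If /(whisker_through G); rewrite whiskerB !whiskerM => st_pf.
have [x [y idGY1]] := coverG.
have [x' [y' idY0]] := t_epi.
pose q := whisker G p \o1 runit G; pose v := whisker G y' \o1 y \o1 q.
exists (runitV G \o1 (whisker G f \o1 v)); split.
  by apply/in2_compl/in2_compr/ideal_whisker.
have qV : q \o1 runitV G = whisker G p by rewrite -compA runitVK compm1.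
rewrite -/q compBr compm1 (compA q) qV (compA (whisker G p)).
have -> : q = whisker G nu \o1 (x \o1 q) + whisker G s2 \o1
   (whisker G lam \o1 (whisker G x' \o1 (y \o1 q)) + whisker G t \o1 v).
  rewrite -{1}[q]comp1m idGY1 compDl -!compA; congr (_ + whisker G s2 \o1 _).
  rewrite -{1}[y]comp1m -whisker1 idY0 whiskerD !whiskerM !compDl.
  by rewrite /v !compA.
rewrite compDr (compA _ (whisker G lam)) whisker_sP -!addrA.
apply: throughD; first by exists (x \o1 q).
apply: throughD.
  by rewrite -!compA; exists (whisker G s1 \o1 (whisker G x' \o1 (y \o1 q))).
by rewrite (compA (whisker G s2)) -compBl; exact: through_compr.
Qed.

Hypothesis indG : indecomposable G.

(** The projection q : P_G -> G N satisfies q = q e = q e^2 = ..., so that a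
    nilpotent e would make it zero. *)
Lemma ideal_contains_duflo (j : obj C) (B B' : cell i j) (b : hom B B') :
  I i j B B' b -> socle_covers B' ->
  ~ through (whisker B' lam) (b \o0 idm Y0) -> I i i G G (idm G).
Proof.
move=> Ib covB' b_n0; have [f [If st_pf]] := ideal_duflo Ib covB' b_n0.
have [e [Ie qe]] := ideal_endo If st_pf.
have [[g [_ <-]]|[n en0]] := fitting e (fiat_add hC i i) indG (fiat_fd hC _ _).
  exact: in2_compr.
case: duflo_acts; move: (whisker G p \o1 runit G) qe => q qe.
suff : through (whisker G nu) (q - q \o1 endo_pow e n).
  by rewrite en0 compm0 subr0.
elim: n {en0} => [|n IH]; first by rewrite compm1 subrr; exact: through0.
have -> : q - q \o1 endo_pow e n.+1 =
    (q - q \o1 endo_pow e n) + q \o1 (idm G - e) \o1 endo_pow e n.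
  by rewrite compBr compm1 compBl addrA subrK /= compA.
by apply: throughD => //; exact: through_compr.
Qed.
End Duflo.

(** * 2-ideals, two-sided cells and quotients *)

Section Ideals.
Variables (k : fieldType) (C : lin2Cat k).

Lemma ideal_leJ (I : ideal2 C) (F G : onemor C) : leJ F G ->
  I _ _ F F (idm (F : cell _ _)) -> I _ _ G G (idm (G : cell _ _)).
Proof.
case=> i j l m {}F {}G H H' [Y [i1 [p1 [_ [_ [pi _ _ _ _]]]]]] /= IF.
apply: ideal_retract pi _; rewrite -!cmp2_id.
exact/in2_cmp2r/in2_cmp2l.
Qed.

Lemma ideal_two_sided_cell (I : ideal2 C) (J : onemor C -> Prop)
  (F G : onemor C) :
  two_sided_cell J -> J F -> J G ->
  I _ _ F F (idm (F : cell _ _)) -> I _ _ G G (idm (G : cell _ _)).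
Proof.
case=> F0 [_ JE] /JE[_ _ leF] /JE[_ leG _] IF.
exact: ideal_leJ leG (ideal_leJ leF IF).
Qed.

Section Preimage.
Variables (K : ideal2 C) (I : ideal2 (quot2 K)).

Section Hom.
Variables (i j : obj C) (F G : cell i j).
Definition preimage_in (a : hom F G) : Prop := I i j F G (qcls K a).
Lemma preimage_in0 : preimage_in 0.
Proof. by rewrite /preimage_in /qcls linear0; exact: inS0. Qed.
Lemma preimage_inP c a b :
  preimage_in a -> preimage_in b -> preimage_in (c *: a + b).
Proof. by rewrite /preimage_in /qcls linearP; exact: inSP. Qed.
Definition preimage_submod := Submod preimage_in0 preimage_inP.
End Hom.

Definition ideal_preimage : ideal2 C.
Proof.
refine (@Ideal2 k C preimage_submod _ _ _ _) => /=; rewrite /preimage_in.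
- by move=> i j F G H b a Ia; rewrite -qcompE; exact: (@in2_compl _ _ I i j).
- by move=> i j F G H b a Ib; rewrite -qcompE; exact: (@in2_compr _ _ I i j).
- move=> i j l G G' F F' b a Ia; rewrite -qcmp2E.
  exact: (@in2_cmp2l _ _ I i j l).
- move=> i j l G G' F F' b a Ib; rewrite -qcmp2E.
  exact: (@in2_cmp2r _ _ I i j l).
Defined.
End Preimage.
End Ideals.

Theorem theorem1 (k : fieldType) (C : lin2Cat k) (hC : fiat C)
  (J L : onemor C -> Prop) (hJ : two_sided_cell J) (hL : left_cell L)
  (hLJ : forall F : onemor C, L F -> J F)
  (i : obj C) (G : cell i i) (LG : rob (Pbar i) i) (hG : is_duflo hC L G LG) :
  J_simple (quot2 (Ker (cell_rep G LG))) (image_of (Ker (cell_rep G LG)) J).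
Proof.
have addC := fiat_add hC i i.
have [LGG [simpleLG [t [epi_t _ _]]] [N [p [duflo_N _]]]] := hG.
have [epi_p [s [[mono_s _ _] [Kq [c [coker_c Kq0]]]]]] := duflo_N.
have JG := hLJ _ LGG.
have indG : indecomposable G by case: hL => F0 [_ LE]; case/LE: LGG.
have zero_cover j (F : cell i j) : is_zero (rfun (Pbar i) F Kq) ->
    forall s', s = acls s' -> socle_covers (amor N) (sq2 s') F.
  move=> FK0 s' sE; rewrite sE in coker_c.
  exact: (cokernel_through addC (F := postcomp i F) coker_c FK0).
have [p' pE] := acls_surj p; have [t' tE] := acls_surj t.
have [s' sE] := acls_surj s.
have {}zero_cover j F FK0 := @zero_cover j F FK0 _ sE.
rewrite pE in epi_p; rewrite tE in epi_t; rewrite sE in mono_s.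
have p_thr := epi_through addC epi_p; have t_thr := epi_through addC epi_t.
rewrite /= in p_thr t_thr.
have s_inj V (y : hom V (atgt LG)) :
    through (amor N) (sq2 s' \o1 y) -> through (amor LG) y.
  by move=> sy; exact: (@mono_through _ _ addC LG N s' V y mono_s sy).
have t_n0 : ~ through (amor LG) (sq2 t').
  move=> t0; case: simpleLG => nLG _; apply/nLG/abel_zero.
  have [x [y ->]] := t_thr; apply: throughD; first by exists x.
  exact: through_compr.
have top_G := fun U w => @simple_through _ _ addC (fiat_fd hC (j := i))
  (fiat_ind hC i i) LG U G w (sq2 t') simpleLG.
have coverG := zero_cover _ _ (Kq0 _ _ LGG).
split.
  move=> _ [F [JF ->]] /=; rewrite /qcls => /(proj1 (qpi0 _ _)) kerF.
  have kerG := @ideal_two_sided_cell _ _ (Ker (cell_rep G LG))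
    _ _ _ hJ JF JG kerF.
  have [S adjS] := fiat_star hC.
  have [[a [b ba]] [a' [b' ba']]] := adjoint_retract (adjS _ _ G).
  (* id_G in the kernel puts id_{G*} there, hence G* G L_G = 0 and G L_G = 0 *)
  have kerSG : Ker (cell_rep G LG) i i (S i i G) (S i i G) (idm _).
    apply: ideal_retract ba' _; rewrite -!cmp2_id.
    exact/in2_cmp2l/in2_cmp2r.
  pose Q := rfun (Pbar i) G LG.
  have orbQ : additive_closure (@orbit _ _ _ _ Q i) Q.
    by apply: ac_in; exists (one i); rewrite rfun1.
  have /= SQ0 := kerSG (exist _ Q orbQ).
  have {}SQ0 : is_zero (rfun (Pbar i) (S i i G) Q).
    by apply: is_zero_id; rewrite -rnat_id.
  have GLG0 : is_zero (rfun (Pbar i) G LG).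
    by apply: (rfun_zero_retract ba); rewrite !rfunM; exact: fun_zero.
  move/abel_zero: GLG0.
  exact: (duflo_nonzero (squareE s') p_thr s_inj t_n0 coverG).
move=> I [j [l [F [F' [a [Ia a0]]]]]].
exists (quot_mor _ (OneMor G)); split; first by exists (OneMor G).
have [a' aE] := qcls_surj a; rewrite aE in Ia a0.
have [[H aH]|noH] := pselect (exists H : cell i j,
  rnat (Pbar i) a' (rfun (Pbar i) H (rfun (Pbar i) G LG)) <> 0); last first.
  case: a0; apply/(proj2 (qpi0 _ _))/ker_add_rep => H.
  by apply/not_notP => aH; apply: noH; exists H.
pose I' := ideal_preimage I.
have Ib : I' _ _ _ _ (a' \o0 idm (H \oo G)) by exact: in2_cmp2r.
apply: (ideal_contains_duflo hC (squareE s') p_thr t_thr s_inj t_n0 top_G coverG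
  indG Ib).
- by apply/zero_cover/rfun_zero_cmp1/rfun_zero_cmp1/Kq0.
- move=> b0; apply: aH; rewrite -(rfunM (Pbar i) H G LG); apply: rnat_cmp2_id.
  exact/acls0P.
Qed.
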